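(* Let $R$ be $\mathbb{Z}$ or, more generally, any kind, unital $*$-subring of $\mathbb{C}$. Let $(n_1,\dots,n_k)$ and $(m_1,\dots,m_l)$ be (weakly) increasing tuples of integers $\ge 2$. If there exists a $*$-ring isomorphism $$\varphi:\bigotimes_{i=1}^k L_{n_i,R}\to\bigotimes_{j=1}^l L_{m_j,R}$$ (tensor products over $R$), then $k=l$ and $(n_1,\dots,n_k)=(m_1,\dots,m_k)$.
   Context: A unital $*$-subring of $\mathbb{C}$ is a subring $R\subseteq\mathbb{C}$ containing $1$ and closed under complex conjugation; its involution is complex conjugation. Such an $R$ is called kind if for all $\lambda_0,\dots,\lambda_n\in R$, $\lambda_0=|\lambda_0|^2+\sum_{i=1}^n|\lambda_i|^2$ implies $\lambda_1=\dots=\lambda_n=0$ (for example, $\mathbb{Z}$ is kind). For $2\le n<\infty$, the Leavitt algebra $L_{n,R}$ is the universal unital $R$-algebra generated by symbols $e_1,\dots,e_n,e_1^*,\dots,e_n^*$ subject to $e_i^*e_j=\delta_{ij}$ and $\sum_{i=1}^n e_ie_i^*=1$. Its canonical involution is the additive extension of $r\,e_{i_1}\cdots e_{i_k}e_{j_l}^*\cdots e_{j_1}^*\mapsto\overline{r}\,e_{j_1}\cdots e_{j_l}e_{i_k}^*\cdots e_{i_1}^*$. Tensor products of $*$-algebras carry the involution $(\sum a\otimes b)^*=\sum a^*\otimes b^*$. A $*$-ring isomorphism is a ring isomorphism commuting with the involutions. Here $k,l\ge1$. *)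

(* Defs.v *)
From HB Require Import structures.
From mathcomp Require Import all_boot all_order all_algebra.
From mathcomp Require Import zify.
From mathcomp Require Import boolp reals complex.

Set Implicit Arguments.
Unset Strict Implicit.
Unset Printing Implicit Defensive.

Import Order.TTheory GRing.Theory Num.Theory.

Local Open Scope ring_scope.
Local Open Scope quotient_scope.

(* Everything is built over MathComp's possibly-zero rings, so that the       *)
(* constructions below are total; MathComp's own algType would require a      *)
(* proof of 1 != 0 for each of them, and HB does not allow a variant of it    *)
(* over pzRingType. An R-algebra is a ring with a morphism from R to its      *)
(* center, and r *: x is written ofbase r * x.                                *)

HB.mixin Record PzRing_hasStar A of GRing.PzRing A := {
  star : A -> A;
  starD : {morph star : x y / x + y};
  starM : forall x y, star (x * y) = star y * star x;
  starK : involutive star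
}.
#[short(type="starRingType")]
HB.structure Definition StarRing := {A of PzRing_hasStar A & GRing.PzRing A}.

#[short(type="comStarRingType")]
HB.structure Definition ComStarRing := {A of StarRing A & GRing.ComPzRing A}.

HB.mixin Record PzRing_isAlg (R : comStarRingType) A of GRing.PzRing A := {
  ofbase : R -> A;
  ofbaseD : {morph ofbase : r s / r + s};
  ofbaseM : {morph ofbase : r s / r * s};
  ofbase1 : ofbase 1 = 1;
  ofbaseC : forall r x, ofbase r * x = x * ofbase r
}.
#[short(type="pzAlgType")]
HB.structure Definition PzAlg (R : comStarRingType) :=
  {A of PzRing_isAlg R A & GRing.PzRing A}.

HB.mixin Record PzAlg_isStarAlg (R : comStarRingType) A
    of StarRing A & PzAlg R A := {
  star_ofbase : forall r : R, star (ofbase r : A) = ofbase (star r)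
}.
#[short(type="starAlgType")]
HB.structure Definition StarAlg (R : comStarRingType) :=
  {A of PzAlg_isStarAlg R A & StarRing A & PzAlg R A}.

Lemma star0 (A : starRingType) : star (0 : A) = 0.
Proof. by apply: (addrI (star 0)); rewrite -starD !addr0. Qed.

Lemma star1 (A : starRingType) : star (1 : A) = 1.
Proof. by rewrite -[LHS]mul1r -[X in X * _]starK -starM mul1r starK. Qed.

Lemma starN (A : starRingType) (x : A) : star (- x) = - star x.
Proof. by apply: (addrI (star x)); rewrite -starD !subrr star0. Qed.

Lemma ofbase0 (R : comStarRingType) (A : pzAlgType R) : ofbase (0 : R) = 0 :> A.
Proof. by apply: (addrI (ofbase 0)); rewrite -ofbaseD !addr0. Qed.

Lemma ofbaseN (R : comStarRingType) (A : pzAlgType R) (r : R) :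
  ofbase (- r) = - ofbase r :> A.
Proof. by apply: (addrI (ofbase r)); rewrite -ofbaseD !subrr ofbase0. Qed.

Definition is_alghom (R : comStarRingType) (A B : pzAlgType R) (f : A -> B) :=
  [/\ {morph f : x y / x + y}, {morph f : x y / x * y} &
      forall r : R, f (ofbase r) = ofbase r].

Section Regular.
Variable R : comStarRingType.
HB.instance Definition _ := StarRing.copy R^o R.
Fact regular_ofbaseC (r : R) (x : R^o) : (r : R^o) * x = x * r.
Proof. exact: mulrC. Qed.
HB.instance Definition _ := PzRing_isAlg.Build R R^o
  (fun _ _ => erefl) (fun _ _ => erefl) erefl regular_ofbaseC.
HB.instance Definition _ := PzAlg_isStarAlg.Build R R^o (fun _ => erefl).
End Regular.

(* The Leavitt algebra: algebra terms in the symbols e_i, e_i^*, modulo the   *)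
(* congruence generated by the R-algebra axioms and the Leavitt relations.    *)
Section Leavitt.
Variables (R : comStarRingType) (n : nat).

Inductive lterm :=
  | LCst of R
  | LGen of 'I_n
  | LGenS of 'I_n
  | LAdd of lterm & lterm
  | LMul of lterm & lterm.

Inductive lrel : lterm -> lterm -> Prop :=
  | lrel_refl x : lrel x x
  | lrel_sym x y : lrel x y -> lrel y x
  | lrel_trans y x z : lrel x y -> lrel y z -> lrel x z
  | lrel_add x x' y y' : lrel x x' -> lrel y y' -> lrel (LAdd x y) (LAdd x' y')
  | lrel_mul x x' y y' : lrel x x' -> lrel y y' -> lrel (LMul x y) (LMul x' y')
  | lrel_addA x y z : lrel (LAdd x (LAdd y z)) (LAdd (LAdd x y) z)
  | lrel_addC x y : lrel (LAdd x y) (LAdd y x)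
  | lrel_add0 x : lrel (LAdd (LCst 0) x) x
  | lrel_addN x : lrel (LAdd (LMul (LCst (- 1)) x) x) (LCst 0)
  | lrel_mulA x y z : lrel (LMul x (LMul y z)) (LMul (LMul x y) z)
  | lrel_mul1 x : lrel (LMul (LCst 1) x) x
  | lrel_mulDl x y z : lrel (LMul (LAdd x y) z) (LAdd (LMul x z) (LMul y z))
  | lrel_mulDr x y z : lrel (LMul x (LAdd y z)) (LAdd (LMul x y) (LMul x z))
  | lrel_cstD r s : lrel (LCst (r + s)) (LAdd (LCst r) (LCst s))
  | lrel_cstM r s : lrel (LCst (r * s)) (LMul (LCst r) (LCst s))
  | lrel_cstC r x : lrel (LMul (LCst r) x) (LMul x (LCst r))
  | lrel_ortho i j : lrel (LMul (LGenS i) (LGen j)) (LCst (i == j)%:R)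
  | lrel_sum : lrel (\big[LAdd/LCst 0]_(i < n) LMul (LGen i) (LGenS i)) (LCst 1).

HB.instance Definition _ := gen_eqMixin lterm.
HB.instance Definition _ := gen_choiceMixin lterm.

Definition lrelb : rel lterm := fun x y => `[< lrel x y >].
Fact lrelb_refl : reflexive lrelb.
Proof. by move=> x; apply/asboolP; exact: lrel_refl. Qed.
Fact lrelb_sym : symmetric lrelb.
Proof. by move=> x y; apply/asboolP/asboolP; exact: lrel_sym. Qed.
Fact lrelb_trans : transitive lrelb.
Proof.
by move=> y x z /asboolP xy /asboolP yz; apply/asboolP; exact: lrel_trans yz.
Qed.
Canonical lrel_equiv := EquivRel lrelb lrelb_refl lrelb_sym lrelb_trans.

Definition leavitt := {eq_quot lrel_equiv}.
HB.instance Definition _ := Choice.on leavitt.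
HB.instance Definition _ := EqQuotient.on leavitt.

Definition lpi (x : lterm) : leavitt := \pi_leavitt x.

Lemma lpiP x y : lpi x = lpi y <-> lrel x y.
Proof. by split=> [/eqmodP/asboolP|xy] //; apply/eqmodP/asboolP. Qed.

Lemma lpiK (u : leavitt) : lpi (repr u) = u.
Proof. exact: reprK. Qed.

Lemma lreprK x : lrel (repr (lpi x)) x.
Proof. by apply/lpiP; rewrite lpiK. Qed.

(* star on terms: conjugate-linear, anti-multiplicative, e_i <-> e_i^*. *)
Fixpoint lstar_term (x : lterm) : lterm :=
  match x with
  | LCst r => LCst (star r)
  | LGen i => LGenS i
  | LGenS i => LGen i
  | LAdd x y => LAdd (lstar_term x) (lstar_term y)
  | LMul x y => LMul (lstar_term y) (lstar_term x)
  end.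

Lemma lstar_rel x y : lrel x y -> lrel (lstar_term x) (lstar_term y).
Proof.
elim=> {x y} /=; try by move=> *; constructor.
- by move=> y x z _ xy _ yz; exact: lrel_trans yz.
- by move=> x; rewrite star0; exact: lrel_add0.
- move=> x; rewrite star0 starN star1; apply: lrel_trans (lrel_addN _).
  by apply: lrel_add (lrel_refl _); apply: lrel_sym; exact: lrel_cstC.
- by move=> x y z; apply: lrel_sym; exact: lrel_mulA.
- move=> x; rewrite star1; apply: lrel_trans (lrel_mul1 _).
  by apply: lrel_sym; exact: lrel_cstC.
- by move=> r s; rewrite starD; exact: lrel_cstD.
- by move=> r s; rewrite starM; exact: lrel_cstM.
- by move=> r x; apply: lrel_sym; exact: lrel_cstC.
- move=> i j; rewrite eq_sym.
  have -> : star ((j == i)%:R : R) = (j == i)%:R.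
    by case: (j == i); rewrite ?star1 ?star0.
  exact: lrel_ortho.
- rewrite star1 (big_morph lstar_term (id1 := LCst 0) (op1 := LAdd)) //=.
    exact: lrel_sum.
  by rewrite star0.
Qed.

Definition ladd (u v : leavitt) := lpi (LAdd (repr u) (repr v)).
Definition lmul (u v : leavitt) := lpi (LMul (repr u) (repr v)).
Definition lopp (u : leavitt) := lpi (LMul (LCst (- 1)) (repr u)).
Definition lstar (u : leavitt) := lpi (lstar_term (repr u)).

Lemma lpiD x y : lpi (LAdd x y) = ladd (lpi x) (lpi y).
Proof.
by apply/lpiP/lrel_sym; apply: lrel_add; exact: lreprK.
Qed.
Lemma lpiM x y : lpi (LMul x y) = lmul (lpi x) (lpi y).
Proof.
by apply/lpiP/lrel_sym; apply: lrel_mul; exact: lreprK.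
Qed.
Lemma lpiN x : lpi (LMul (LCst (- 1)) x) = lopp (lpi x).
Proof.
by apply/lpiP/lrel_sym; apply: lrel_mul (lrel_refl _) _; exact: lreprK.
Qed.
Lemma lpi_star x : lpi (lstar_term x) = lstar (lpi x).
Proof. by apply/lpiP/lrel_sym/lstar_rel; exact: lreprK. Qed.

Fact laddA : associative ladd.
Proof.
move=> u v w; rewrite -(lpiK u) -(lpiK v) -(lpiK w) -!lpiD.
by apply/lpiP; exact: lrel_addA.
Qed.
Fact laddC : commutative ladd.
Proof.
move=> u v; rewrite -(lpiK u) -(lpiK v) -!lpiD.
by apply/lpiP; exact: lrel_addC.
Qed.
Fact ladd0 : left_id (lpi (LCst 0)) ladd.
Proof.
by move=> u; rewrite -(lpiK u) -lpiD; apply/lpiP; exact: lrel_add0.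
Qed.
Fact lmulA : associative lmul.
Proof.
move=> u v w; rewrite -(lpiK u) -(lpiK v) -(lpiK w) -!lpiM.
by apply/lpiP; exact: lrel_mulA.
Qed.
Fact lmul1 : left_id (lpi (LCst 1)) lmul.
Proof.
by move=> u; rewrite -(lpiK u) -lpiM; apply/lpiP; exact: lrel_mul1.
Qed.
Fact lmulDl : left_distributive lmul ladd.
Proof.
move=> u v w; rewrite -(lpiK u) -(lpiK v) -(lpiK w) -!(lpiM, lpiD).
by apply/lpiP; exact: lrel_mulDl.
Qed.
Fact lmulDr : right_distributive lmul ladd.
Proof.
move=> u v w; rewrite -(lpiK u) -(lpiK v) -(lpiK w) -!(lpiM, lpiD).
by apply/lpiP; exact: lrel_mulDr.
Qed.
Lemma lpi_cstD r s : lpi (LCst (r + s)) = ladd (lpi (LCst r)) (lpi (LCst s)).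
Proof. by rewrite -lpiD; apply/lpiP; exact: lrel_cstD. Qed.
Lemma lpi_cstM r s : lpi (LCst (r * s)) = lmul (lpi (LCst r)) (lpi (LCst s)).
Proof. by rewrite -lpiM; apply/lpiP; exact: lrel_cstM. Qed.
Lemma lcstC r u : lmul (lpi (LCst r)) u = lmul u (lpi (LCst r)).
Proof. by rewrite -(lpiK u) -!lpiM; apply/lpiP; exact: lrel_cstC. Qed.
Fact lmulr1 : right_id (lpi (LCst 1)) lmul.
Proof. by move=> u; rewrite -lcstC lmul1. Qed.
Fact laddN : left_inverse (lpi (LCst 0)) lopp ladd.
Proof.
by move=> u; rewrite -(lpiK u) -lpiN -lpiD; apply/lpiP; exact: lrel_addN.
Qed.

HB.instance Definition _ :=
  GRing.isZmodule.Build leavitt laddA laddC ladd0 laddN.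
HB.instance Definition _ :=
  GRing.Zmodule_isPzRing.Build leavitt lmulA lmul1 lmulr1 lmulDl lmulDr.

HB.instance Definition _ := PzRing_isAlg.Build R leavitt
  lpi_cstD lpi_cstM erefl lcstC.

Fact lstarD : {morph lstar : u v / u + v}.
Proof.
by move=> u v; rewrite -[u + v]/(lpi _) -lpi_star /=; exact: lpiD.
Qed.
Fact lstarM u v : lstar (u * v) = lstar v * lstar u.
Proof. by rewrite -[u * v]/(lpi _) -lpi_star /=; exact: lpiM. Qed.
Fact lstarK : involutive lstar.
Proof.
move=> u; rewrite -(lpiK u) -!lpi_star; congr lpi.
by elim: (repr u) => //= [r|x -> y ->|x -> y ->] //; rewrite starK.
Qed.
HB.instance Definition _ := PzRing_hasStar.Build leavitt lstarD lstarM lstarK.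

Fact lstar_cst r : star (lpi (LCst r)) = lpi (LCst (star r)).
Proof. by rewrite /star /= -lpi_star. Qed.
HB.instance Definition _ := PzAlg_isStarAlg.Build R leavitt lstar_cst.

Definition lgen (i : 'I_n) : leavitt := lpi (LGen i).
Definition lgenS (i : 'I_n) : leavitt := lpi (LGenS i).

Lemma lpi_addE x y : lpi (LAdd x y) = lpi x + lpi y.
Proof. exact: lpiD. Qed.
Lemma lpi_mulE x y : lpi (LMul x y) = lpi x * lpi y.
Proof. exact: lpiM. Qed.
Lemma lpi_cstE r : lpi (LCst r) = ofbase r.
Proof. by []. Qed.

Definition leavitt_rel (A : pzAlgType R) (e es : 'I_n -> A) :=
  (forall i j, es i * e j = (i == j)%:R) /\ \sum_(i < n) e i * es i = 1.

Lemma lgen_rel : leavitt_rel lgen lgenS.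
Proof.
split=> [i j|].
  rewrite -lpi_mulE; have /lpiP -> := lrel_ortho i j.
  by rewrite lpi_cstE; case: (i == j); rewrite ?ofbase1 ?ofbase0.
have /lpiP := lrel_sum.
rewrite lpi_cstE ofbase1 => <-.
rewrite (big_morph lpi lpi_addE (erefl _ : lpi (LCst 0) = 0)).
by apply: eq_bigr => i _; rewrite lpi_mulE.
Qed.

Lemma star_lgen i : star (lgen i) = lgenS i.
Proof. by rewrite /star /= -lpi_star. Qed.
Lemma star_lgenS i : star (lgenS i) = lgen i.
Proof. by rewrite -star_lgen starK. Qed.

(* star is the additive extension of the usual formula on monomials. *)
Lemma star_monomial r (I J : seq 'I_n) :
  star (ofbase r * (\prod_(i <- I) lgen i * \prod_(j <- rev J) lgenS j)) =
  ofbase (star r) * (\prod_(j <- J) lgen j * \prod_(i <- rev I) lgenS i).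
Proof.
have H (f g : 'I_n -> leavitt) K : (forall i, star (f i) = g i) ->
    star (\prod_(i <- K) f i) = \prod_(i <- rev K) g i.
  move=> fg; elim: K => [|i K IH]; first by rewrite !big_nil star1.
  by rewrite big_cons starM IH rev_cons big_rcons /= fg.
rewrite starM star_ofbase -ofbaseC starM (H lgen lgenS) ?(H lgenS lgen) ?revK //.
  exact: star_lgenS.
exact: star_lgen.
Qed.

Section Universal.
Variables (A : pzAlgType R) (e es : 'I_n -> A).

Fixpoint leval (x : lterm) : A :=
  match x with
  | LCst r => ofbase r
  | LGen i => e i
  | LGenS i => es i
  | LAdd x y => leval x + leval y
  | LMul x y => leval x * leval y
  end.

Hypothesis hrel : leavitt_rel e es.

Lemma leval_rel x y : lrel x y -> leval x = leval y.
Proof.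
elim=> {x y} //=.
- by move=> y x z _ -> _ ->.
- by move=> x x' y y' _ -> _ ->.
- by move=> x x' y y' _ -> _ ->.
- by move=> *; rewrite addrA.
- by move=> *; rewrite addrC.
- by move=> x; rewrite ofbase0 add0r.
- by move=> x; rewrite ofbaseN ofbase1 mulN1r addNr ofbase0.
- by move=> *; rewrite mulrA.
- by move=> x; rewrite ofbase1 mul1r.
- by move=> *; rewrite mulrDl.
- by move=> *; rewrite mulrDr.
- by move=> *; rewrite ofbaseD.
- by move=> *; rewrite ofbaseM.
- by move=> *; rewrite ofbaseC.
- move=> i j; rewrite hrel.1; by case: (i == j); rewrite ?ofbase1 ?ofbase0.
have e0 : leval (LCst 0) = 0 by exact: ofbase0.
rewrite (big_morph leval (fun _ _ => erefl) e0) /= ofbase1.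
exact: hrel.2.
Qed.

Lemma leavitt_universal :
  exists! f : leavitt -> A,
    is_alghom f /\ forall i, f (lgen i) = e i /\ f (lgenS i) = es i.
Proof.
pose f (u : leavitt) := leval (repr u).
have fpi x : f (lpi x) = leval x by apply: leval_rel; exact: lreprK.
exists f; split; first split.
- split.
  + by move=> u v; rewrite -(lpiK u) -(lpiK v) -lpi_addE !fpi.
  + by move=> u v; rewrite -(lpiK u) -(lpiK v) -lpi_mulE !fpi.
  + by move=> r; rewrite -lpi_cstE fpi.
- by move=> i; rewrite !fpi.
move=> g [[gD gM gC] gE]; apply/funext => u.
rewrite -(lpiK u) fpi; elim: (repr u) => /= [r|i|i|x IHx y IHy|x IHx y IHy].
- by rewrite lpi_cstE gC.
- by have [-> _] := gE i.
- by have [_ ->] := gE i.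
- by rewrite lpi_addE gD IHx IHy.
- by rewrite lpi_mulE gM IHx IHy.
Qed.
End Universal.
End Leavitt.

(* The tensor product over R: formal sums of pure tensors modulo the          *)
(* bilinear, R-balanced relations.                                            *)
Section Tensor.
Variables (R : comStarRingType) (A B : starAlgType R).

Inductive tterm :=
  | TPure of A & B
  | TAdd of tterm & tterm.

Inductive trel : tterm -> tterm -> Prop :=
  | trel_refl x : trel x x
  | trel_sym x y : trel x y -> trel y x
  | trel_trans y x z : trel x y -> trel y z -> trel x z
  | trel_add x x' y y' : trel x x' -> trel y y' -> trel (TAdd x y) (TAdd x' y')
  | trel_addA x y z : trel (TAdd x (TAdd y z)) (TAdd (TAdd x y) z)
  | trel_addC x y : trel (TAdd x y) (TAdd y x)
  | trel_add0 x : trel (TAdd (TPure 0 0) x) x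
  | trel_pureDl a a' b : trel (TPure (a + a') b) (TAdd (TPure a b) (TPure a' b))
  | trel_pureDr a b b' : trel (TPure a (b + b')) (TAdd (TPure a b) (TPure a b'))
  | trel_pureZ (r : R) a b : 
      trel (TPure (ofbase r * a) b) (TPure a (ofbase r * b)).

HB.instance Definition _ := gen_eqMixin tterm.
HB.instance Definition _ := gen_choiceMixin tterm.

Definition trelb : rel tterm := fun x y => `[< trel x y >].
Fact trelb_refl : reflexive trelb.
Proof. by move=> x; apply/asboolP; exact: trel_refl. Qed.
Fact trelb_sym : symmetric trelb.
Proof. by move=> x y; apply/asboolP/asboolP; exact: trel_sym. Qed.
Fact trelb_trans : transitive trelb.
Proof.
by move=> y x z /asboolP xy /asboolP yz; apply/asboolP; exact: trel_trans yz.
Qed.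
Canonical trel_equiv := EquivRel trelb trelb_refl trelb_sym trelb_trans.

Definition tensor := {eq_quot trel_equiv}.
HB.instance Definition _ := Choice.on tensor.
HB.instance Definition _ := EqQuotient.on tensor.

Definition tpi (x : tterm) : tensor := \pi_tensor x.

Lemma tpiP x y : tpi x = tpi y <-> trel x y.
Proof. by split=> [/eqmodP/asboolP|xy] //; apply/eqmodP/asboolP. Qed.
Lemma tpiK (u : tensor) : tpi (repr u) = u.
Proof. exact: reprK. Qed.
Lemma treprK x : trel (repr (tpi x)) x.
Proof. by apply/tpiP; rewrite tpiK. Qed.

Fixpoint topp_term (x : tterm) : tterm :=
  match x with
  | TPure a b => TPure (- a) b
  | TAdd x y => TAdd (topp_term x) (topp_term y)
  end.

Definition tadd (u v : tensor) := tpi (TAdd (repr u) (repr v)).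
Definition topp (u : tensor) := tpi (topp_term (repr u)).

Lemma tpi_add x y : tpi (TAdd x y) = tadd (tpi x) (tpi y).
Proof. by apply/tpiP/trel_sym; apply: trel_add; exact: treprK. Qed.

Fact taddA : associative tadd.
Proof.
move=> u v w; rewrite -(tpiK u) -(tpiK v) -(tpiK w) -!tpi_add.
by apply/tpiP; exact: trel_addA.
Qed.
Fact taddC : commutative tadd.
Proof.
move=> u v; rewrite -(tpiK u) -(tpiK v) -!tpi_add.
by apply/tpiP; exact: trel_addC.
Qed.
Fact tadd0 : left_id (tpi (TPure 0 0)) tadd.
Proof.
by move=> u; rewrite -(tpiK u) -tpi_add; apply/tpiP; exact: trel_add0.
Qed.
Fact taddN : left_inverse (tpi (TPure 0 0)) topp tadd.
Proof.
move=> u; rewrite -[in X in tadd _ X](tpiK u) /topp.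
elim: (repr u) => [a b|x IHx y IHy] /=; last first.
  rewrite !tpi_add -!taddA [tadd (tpi (topp_term y)) _]taddC -!taddA.
  by rewrite [tadd (tpi y) _]taddC IHy [tadd (tpi x) _]taddC tadd0.
rewrite -tpi_add; apply/tpiP.
apply: trel_trans (trel_sym (trel_pureDl _ _ _)) _.
rewrite addNr -[X in TPure X b](mulr0 (ofbase 0)).
apply: trel_trans (trel_pureZ _ _ _) _.
by rewrite ofbase0 mul0r; exact: trel_refl.
Qed.

HB.instance Definition _ :=
  GRing.isZmodule.Build tensor taddA taddC tadd0 taddN.

Definition pure (a : A) (b : B) : tensor := tpi (TPure a b).

Definition balanced (V : zmodType) (f : A -> B -> V) :=
  [/\ forall a a' b, f (a + a') b = f a b + f a' b,
      forall a b b', f a (b + b') = f a b + f a b' &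
      forall (r : R) a b, f (ofbase r * a) b = f a (ofbase r * b)].

Lemma pure_balanced : balanced pure.
Proof.
split=> [a a' b|a b b'|r a b].
- by rewrite -[RHS]tpi_add; apply/tpiP; exact: trel_pureDl.
- by rewrite -[RHS]tpi_add; apply/tpiP; exact: trel_pureDr.
- by apply/tpiP; exact: trel_pureZ.
Qed.
Lemma pureDl a a' b : pure (a + a') b = pure a b + pure a' b.
Proof. by case: pure_balanced => + _ _; exact. Qed.
Lemma pureDr a b b' : pure a (b + b') = pure a b + pure a b'.
Proof. by case: pure_balanced => _ + _; exact. Qed.
Lemma pureZ r a b : pure (ofbase r * a) b = pure a (ofbase r * b).
Proof. by case: pure_balanced => _ _; exact. Qed.

Lemma tensor_ind (P : tensor -> Prop) :
  (forall a b, P (pure a b)) -> (forall u v, P u -> P v -> P (u + v)) ->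
  forall u, P u.
Proof.
move=> Pp PD u; rewrite -(tpiK u); elim: (repr u) => [a b|x Px y Py].
  exact: Pp.
by rewrite tpi_add; exact: PD.
Qed.

Section Lift.
Variables (V : zmodType) (f : A -> B -> V).
Fixpoint teval (x : tterm) : V :=
  match x with
  | TPure a b => f a b
  | TAdd x y => teval x + teval y
  end.
Definition tlift (u : tensor) : V := teval (repr u).

Hypothesis fbal : balanced f.

Lemma teval_rel x y : trel x y -> teval x = teval y.
Proof.
case: fbal => fDl fDr fZ; elim=> {x y} //=.
- by move=> y x z _ -> _ ->.
- by move=> x x' y y' _ -> _ ->.
- by move=> *; rewrite addrA.
- by move=> *; rewrite addrC.
- move=> x; suff -> : f 0 0 = 0 by rewrite add0r.
  by apply: (addrI (f 0 0)); rewrite -fDl !addr0.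
Qed.
Lemma tlift_pure a b : tlift (pure a b) = f a b.
Proof. by rewrite -[RHS]/(teval (TPure a b)); apply/teval_rel/treprK. Qed.
Lemma tliftD : {morph tlift : u v / u + v}.
Proof.
move=> u v; rewrite -[RHS]/(teval (TAdd (repr u) (repr v))).
by apply/teval_rel/treprK.
Qed.
Lemma tensor_universal :
  exists! g : tensor -> V,
    {morph g : u v / u + v} /\ forall a b, g (pure a b) = f a b.
Proof.
exists tlift; split; first by split; [exact: tliftD | exact: tlift_pure].
move=> g [gD gE]; apply/funext; apply: tensor_ind => [a b|u v IHu IHv].
  by rewrite gE tlift_pure.
by rewrite gD tliftD IHu IHv.
Qed.
End Lift.

(* (a (x) b) (c (x) d) = ac (x) bd *)
Definition tmulp (a : A) (b : B) : tensor -> tensor :=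
  tlift (fun c d => pure (a * c) (b * d)).
Definition tmul (u v : tensor) : tensor := tlift (fun a b => tmulp a b v) u.
Definition tbase (r : R) : tensor := pure (ofbase r) 1.
Definition tstar : tensor -> tensor :=
  tlift (fun a b => pure (star a) (star b)).

Fact tmulp_bal a b : balanced (fun c d => pure (a * c) (b * d)).
Proof.
split=> [c c' d|c d d'|r c d].
- by rewrite mulrDr pureDl.
- by rewrite mulrDr pureDr.
- by rewrite mulrA -ofbaseC -mulrA pureZ mulrA ofbaseC mulrA.
Qed.
Lemma tmulpE a b c d : tmulp a b (pure c d) = pure (a * c) (b * d).
Proof. by rewrite /tmulp tlift_pure //; exact: tmulp_bal. Qed.
Lemma tmulpD a b : {morph tmulp a b : u v / u + v}.
Proof. by apply: tliftD; exact: tmulp_bal. Qed.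
Fact tmul_bal v : balanced (fun a b => tmulp a b v).
Proof.
split=> [a a' b|a b b'|r a b]; elim/tensor_ind: v => [c d|u v IHu IHv].
- by rewrite !tmulpE mulrDl pureDl.
- by rewrite !tmulpD IHu IHv addrACA.
- by rewrite !tmulpE mulrDl pureDr.
- by rewrite !tmulpD IHu IHv addrACA.
- by rewrite !tmulpE -!mulrA pureZ.
- by rewrite !tmulpD IHu IHv.
Qed.
Lemma tmul_pure a b c d : tmul (pure a b) (pure c d) = pure (a * c) (b * d).
Proof. by rewrite /tmul tlift_pure ?tmulpE //; exact: tmul_bal. Qed.
Fact tmulDl : left_distributive tmul +%R.
Proof. by move=> u v w; rewrite /tmul tliftD //; exact: tmul_bal. Qed.
Fact tmulDr : right_distributive tmul +%R.
Proof.
move=> u v w; elim/tensor_ind: u => [a b|u u' IH IH'].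
  by rewrite /tmul !tlift_pure ?tmulpD //; exact: tmul_bal.
by rewrite !tmulDl IH IH' addrACA.
Qed.
Fact tmulA : associative tmul.
Proof.
move=> u v w; elim/tensor_ind: u => [a b|u u' IH IH']; last first.
  by rewrite !tmulDl IH IH'.
elim/tensor_ind: v => [c d|v v' IH IH']; last first.
  by rewrite !(tmulDl, tmulDr) IH IH'.
elim/tensor_ind: w => [c' d'|w w' IH IH']; last by rewrite !tmulDr IH IH'.
by rewrite !tmul_pure !mulrA.
Qed.
Fact tmul1 : left_id (pure 1 1) tmul.
Proof.
by elim/tensor_ind=> [a b|u v IH IH']; rewrite ?tmul_pure ?mul1r ?tmulDr ?IH ?IH'.
Qed.
Fact tmulr1 : right_id (pure 1 1) tmul.
Proof.
by elim/tensor_ind=> [a b|u v IH IH']; rewrite ?tmul_pure ?mulr1 ?tmulDl ?IH ?IH'.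
Qed.
HB.instance Definition _ :=
  GRing.Zmodule_isPzRing.Build tensor tmulA tmul1 tmulr1 tmulDl tmulDr.

Lemma pureM a b c d : pure a b * pure c d = pure (a * c) (b * d).
Proof. exact: tmul_pure. Qed.
Fact tbaseD : {morph tbase : r s / r + s}.
Proof. by move=> r s; rewrite /tbase ofbaseD pureDl. Qed.
Fact tbaseM : {morph tbase : r s / r * s}.
Proof. by move=> r s; rewrite /tbase ofbaseM pureM mulr1. Qed.
Fact tbase1 : tbase 1 = 1.
Proof. by rewrite /tbase ofbase1. Qed.
Fact tbaseC r (u : tensor) : tbase r * u = u * tbase r.
Proof.
elim/tensor_ind: u => [a b|u v IH IH']; last by rewrite mulrDl mulrDr IH IH'.
by rewrite !pureM ofbaseC mul1r mulr1.
Qed.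
HB.instance Definition _ :=
  PzRing_isAlg.Build R tensor tbaseD tbaseM tbase1 tbaseC.

Lemma scale_pure (r : R) a b : ofbase r * pure a b = pure (ofbase r * a) b.
Proof. by rewrite /ofbase /= /tbase pureM mul1r. Qed.

Fact tstar_bal : balanced (fun a b => pure (star a) (star b)).
Proof.
split=> [a a' b|a b b'|r a b].
- by rewrite starD pureDl.
- by rewrite starD pureDr.
- by rewrite !starM !star_ofbase -!ofbaseC pureZ.
Qed.
Lemma tstar_pure a b : tstar (pure a b) = pure (star a) (star b).
Proof. by rewrite /tstar tlift_pure //; exact: tstar_bal. Qed.
Fact tstarD : {morph tstar : u v / u + v}.
Proof. by apply: tliftD; exact: tstar_bal. Qed.
Fact tstarM u v : tstar (u * v) = tstar v * tstar u.
Proof.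
elim/tensor_ind: u => [a b|u u' IH IH']; last first.
  by rewrite mulrDl !tstarD mulrDr IH IH'.
elim/tensor_ind: v => [c d|v v' IH IH'].
  by rewrite !(pureM, tstar_pure) !starM.
by rewrite mulrDr !tstarD mulrDl IH IH'.
Qed.
Fact tstarK : involutive tstar.
Proof.
by elim/tensor_ind=> [a b|u v IH IH']; rewrite ?tstar_pure ?starK ?tstarD ?IH ?IH'.
Qed.
HB.instance Definition _ := PzRing_hasStar.Build tensor tstarD tstarM tstarK.

Lemma star_pure a b : star (pure a b) = pure (star a) (star b).
Proof. exact: tstar_pure. Qed.

Fact tstar_base r : star (tbase r) = tbase (star r).
Proof. by rewrite /tbase star_pure star_ofbase star1. Qed.
HB.instance Definition _ := PzAlg_isStarAlg.Build R tensor tstar_base.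
End Tensor.

(* A_1 (x) (A_2 (x) (... (x) A_k)); the empty tensor product is R. *)
Fixpoint bigtensor (R : comStarRingType) (As : seq (starAlgType R)) :
    starAlgType R :=
  match As with
  | [::] => R^o
  | [:: A] => A
  | A :: As' => tensor A (bigtensor As')
  end.

Definition leavitt_tensor (R : comStarRingType) (ns : seq nat) :
    starAlgType R :=
  bigtensor [seq (leavitt R n : starAlgType R) | n <- ns].

HB.mixin Record isConjClosed (K : realType) (S : {pred K[i]}) := {
  conj_closed : {in S, forall z, conjc z \in S}
}.
(* The unital *-subrings of the complex numbers K[i]. *)
#[short(type="starSubring")]
HB.structure Definition StarSubring (K : realType) :=
  {S of isConjClosed K S & GRing.SubringClosed K[i] S}.

Section SubringType.
Variables (K : realType) (S : starSubring K).

Definition subring_type := {z : K[i] | z \in S}.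
HB.instance Definition _ := SubChoice.on subring_type.
HB.instance Definition _ :=
  [SubChoice_isSubComNzRing of subring_type by <:].

Definition sconj (x : subring_type) : subring_type :=
  Sub (conjc (val x)) (conj_closed _ (valP x)).

Fact sconjD : {morph sconj : x y / x + y}.
Proof. by move=> x y; apply: val_inj; rewrite /= raddfD. Qed.
Fact sconjM x y : sconj (x * y) = sconj y * sconj x.
Proof. by apply: val_inj; rewrite /= rmorphM mulrC. Qed.
Fact sconjK : involutive sconj.
Proof. by move=> x; apply: val_inj; rewrite /= conjcK. Qed.
HB.instance Definition _ :=
  PzRing_hasStar.Build subring_type sconjD sconjM sconjK.
End SubringType.

Definition kind (K : realType) (S : {pred K[i]}) :=
  forall (z : K[i]) (s : seq K[i]), z \in S -> {subset s <= S} ->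
    z = `|z| ^+ 2 + \sum_(w <- s) `|w| ^+ 2 -> forall w, w \in s -> w = 0.

Definition is_starring_iso (A B : starRingType) (f : A -> B) :=
  [/\ bijective f, {morph f : x y / x + y}, {morph f : x y / x * y}, f 1 = 1 &
      forall x, f (star x) = star (f x)].

Section IntSub.
Variable K : realType.
Definition Zsub : {pred K[i]} := fun z => `[< exists m : int, z = m%:~R >].
Fact Zsub_sub : subring_closed Zsub.
Proof.
split; first by apply/asboolP; exists 1.
- by move=> _ _ /asboolP[a ->] /asboolP[b ->]; apply/asboolP; exists (a - b);
  rewrite rmorphB.
- by move=> _ _ /asboolP[a ->] /asboolP[b ->]; apply/asboolP; exists (a * b);
  rewrite rmorphM.
Qed.
Fact Zsub_conj : {in Zsub, forall z, conjc z \in Zsub}.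
Proof.
by move=> _ /asboolP[a ->]; apply/asboolP; exists a; rewrite rmorph_int.
Qed.
HB.instance Definition _ := GRing.isSubringClosed.Build K[i] Zsub Zsub_sub.
HB.instance Definition _ := isConjClosed.Build K Zsub Zsub_conj.
Lemma Zsub_kind : kind Zsub.
Proof.
move=> z s /asboolP[m ->] _ e w ws; apply/eqP.
have s0 : forall u, u \in s -> 0 <= `|u| ^+ 2 by move=> *; rewrite exprn_ge0.
have sle : \sum_(u <- s) `|u| ^+ 2 <= 0.
  have -> : \sum_(u <- s) `|u| ^+ 2 = (m - `|m| ^+ 2)%:~R :> K[i].
    have -> : (m - `|m| ^+ 2)%:~R = m%:~R - `|m%:~R| ^+ 2 :> K[i]
      by rewrite intrB rmorphXn /= intr_norm.
    by rewrite [X in _ = X - _]e addrC addKr.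
  rewrite (ler_int K[i] _ 0) subr_le0 real_normK ?num_real //.
  by case: m {e} => [[|n]|n] //; rewrite ?NegzE; nia.
have : \sum_(u <- s) `|u| ^+ 2 == 0.
  by rewrite eq_le sle big_seq_cond sumr_ge0 // => u /andP[/s0].
rewrite big_seq psumr_eq0 // => /allP /(_ w ws).
by rewrite ws /= expf_eq0 /= normr_eq0.
Qed.
End IntSub.

(* Main.v *)
Require Import Defs.
From HB Require Import structures.
From mathcomp Require Import all_boot all_order all_algebra.
From mathcomp Require Import zify ring.
From mathcomp Require Import boolp reals complex.

(* A kind *-subring [S] forces a partial isometry [v] of a tensor product of  *)
(* Leavitt algebras to be monomial: for the action on functions on the space  *)
(* [X] of tuples of infinite words, [v] maps the indicator of a point to a    *)
(* multiple of the indicator of a point (or to 0), and the resulting partial  *)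
(* map of [X] locally replaces prefixes. In particular projections are        *)
(* indicators of clopen sets, and a *-isomorphism [phi] induces a             *)
(* homeomorphism [h] of the two spaces intertwining these partial maps.       *)
(*                                                                            *)
(* At the point [x0] with all letters 0, the [i]-th generator of letter 0     *)
(* fixes exactly the points whose [i]-th coordinate is constant 0. Its image  *)
(* replaces prefixes near [h x0], and fixes the points agreeing with [h x0]   *)
(* on the set [s i] of coordinates where the prefix lengths differ. Hence     *)
(* [s i] is not covered by the other [s i'], which injects the factors on the *)
(* left into those on the right. When both sides have the same number of      *)
(* factors [s i] is a singleton [sigma i], and [h] maps the slice at [x0] in  *)
(* direction [i] locally onto the slice at [h x0] in direction [sigma i].     *)
(* Counting words modulo [m - 1] (the group H_0 of the one-sided shift on [m] *)
(* letters) then gives [m (sigma i) - 1 %| n i - 1], and symmetry concludes.  *)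

Set Implicit Arguments.
Unset Strict Implicit.
Unset Printing Implicit Defensive.

Import Order.TTheory GRing.Theory Num.Theory.

(** * Tensor products of Leavitt algebras by generators and relations *)

Local Open Scope ring_scope.

(** A tensor product of Leavitt algebras acts by matrices with rows and columns indexed by tuples of
    infinite words: a generator prepends a letter in its coordinate. Entries lie in [S] and the star
    is the conjugate transpose. For a projection [p], the equation [p = star p * p] says that p_xx
    is the sum over z of |p_zx|^2, so kindness makes [p] diagonal ([proj_off]). A rescaling gives at
    most one nonzero entry in each column of a partial isometry ([pisom_delta]).

    Multiplying by a long enough monomial cancels all starred generators ([spanned_deep]), and
    distinct monomials are separated by an aperiodic point. This yields faithfulness
    ([rho_faithful]) and shows that partial isometries replace prefixes locally ([pisom_local]).
    Projections thus behave as clopen sets, and a point is recovered from the projections containing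
    it. An isomorphism therefore transports points ([point_image]) and intertwines the partial maps
    ([sends_image]).

    Fixed points of the generators near the zero point give an injection of factors
    ([axes_matching]), hence equal numbers of factors by symmetry. One-dimensional slices then
    correspond, so a shift on p+1 letters embeds as a clopen piece of a shift on q+1 letters. Its
    class r in Z/q satisfies (p+1) r = r and is invertible, so q divides p ([embedded_shift_dvd]).
    Divisibility in both directions along bijections forces the two multisets to coincide
    ([dvd_bij_perm]). *)

Record multi_leavitt_rel (R : comStarRingType) (I : finType) (n : I -> nat)
    (A : pzAlgType R) (e es : forall i, 'I_(n i).+1 -> A) : Prop := {
  mlr_ortho : forall i a b, es i a * e i b = (a == b)%:R;
  mlr_sum : forall i, \sum_a e i a * es i a = 1;
  mlr_ee : forall i j a b, i != j -> e i a * e j b = e j b * e i a;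
  mlr_ss : forall i j a b, i != j -> es i a * es j b = es j b * es i a;
  mlr_es : forall i j a b, i != j -> e i a * es j b = es j b * e i a }.

(* [A] is a tensor product over [I] of Leavitt algebras, the [i]-th of which  *)
(* has [(n i).+1] generators; the index shift keeps every alphabet nonempty.  *)
Record multi_leavitt (R : comStarRingType) (I : finType) (n : I -> nat)
    (A : starAlgType R) (g : forall i, 'I_(n i).+1 -> A) : Prop := {
  ml_rel : multi_leavitt_rel g (fun i a => star (g i a));
  ml_ind : forall P : A -> Prop, (forall r, P (ofbase r)) ->
    (forall i a, P (g i a)) -> (forall i a, P (star (g i a))) ->
    (forall x y, P x -> P y -> P (x + y)) ->
    (forall x y, P x -> P y -> P (x * y)) -> forall x, P x;
  ml_univ : forall (B : pzAlgType R) (e es : forall i, 'I_(n i).+1 -> B),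
    multi_leavitt_rel e es -> exists f : A -> B,
      is_alghom f /\ forall i a, f (g i a) = e i a /\ f (star (g i a)) = es i a }.

Lemma leavitt_ind (R : comStarRingType) n (P : leavitt R n -> Prop) :
  (forall r, P (ofbase r)) -> (forall a, P (lgen R a)) ->
  (forall a, P (lgenS R a)) -> (forall x y, P x -> P y -> P (x + y)) ->
  (forall x y, P x -> P y -> P (x * y)) -> forall x, P x.
Proof.
move=> Pc Pg Ps PD PM x; rewrite -(lpiK x).
elim: (repr x) => [r|a|a|y IHy z IHz|y IHy z IHz].
- exact: Pc.
- exact: Pg.
- exact: Ps.
- by rewrite lpi_addE; exact: PD.
- by rewrite lpi_mulE; exact: PM.
Qed.

Lemma multi_leavitt_unit (R : comStarRingType) p :
  @multi_leavitt R unit (fun=> p) (leavitt R p.+1) (fun _ a => lgen R a).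
Proof.
have [ortho sum1] := lgen_rel R p.+1.
split.
- split=> [i a b|i|[] []|[] []|[] []] //.
    by rewrite star_lgen.
  by rewrite -[RHS]sum1; apply: eq_bigr => a _; rewrite star_lgen.
- move=> P Pc Pg Ps PD PM; apply: leavitt_ind => // a; first exact: (Pg tt).
  by rewrite -star_lgen; exact: (Ps tt).
- move=> B e es [eo es1 _ _ _].
  have [f [[fh fE] _]] := leavitt_universal (conj (eo tt) (es1 tt)).
  by exists f; split=> // -[] a; rewrite star_lgen.
Qed.

Section SumSystem.
Variables (R : comStarRingType) (I J : finType) (n : I -> nat) (m : J -> nat).

Definition sum_arity (i : I + J) : nat :=
  match i with inl i => n i | inr j => m j end.

Definition sum_gens (A : Type) (u : forall i, 'I_(n i).+1 -> A)
    (v : forall j, 'I_(m j).+1 -> A) (i : I + J) : 'I_(sum_arity i).+1 -> A :=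
  match i with inl i => u i | inr j => v j end.

(** For universality, the two factors are mapped separately. Commutation of generators from
    different factors propagates to the whole images, so the product of the two maps is balanced and
    multiplicative. *)
Lemma multi_leavitt_tensor (A B : starAlgType R) gA gB :
  multi_leavitt gA -> multi_leavitt gB ->
  @multi_leavitt R (I + J)%type sum_arity (tensor A B : starAlgType R)
    (sum_gens (fun i a => pure (gA i a) (1 : B))
              (fun j a => pure (1 : A) (gB j a))).
Proof.
move=> [[oA sA eeA ssA esA] indA univA] [[oB sB eeB ssB esB] indB univB].
pose g := sum_gens (fun i a => pure (gA i a) (1 : B))
              (fun j a => pure (1 : A) (gB j a)).
have pure0l (b : B) : pure (0 : A) b = 0.
  by apply: (addrI (pure 0 b)); rewrite -pureDl !addr0.
have pure0r (a : A) : pure a (0 : B) = 0.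
  by apply: (addrI (pure a 0)); rewrite -pureDr !addr0.
have pure11 : pure (1 : A) (1 : B) = 1 by [].
split.
- split=> [[i|j] a b|[i|j]|[i|j] [i'|j'] a b ne|[i|j] [i'|j'] a b ne|
           [i|j] [i'|j'] a b ne] /=; rewrite ?star_pure ?star1 ?pureM ?mulr1 ?mul1r //.
  + by rewrite oA; case: eqP; rewrite ?pure11 ?pure0l.
  + by rewrite oB; case: eqP; rewrite ?pure11 ?pure0r.
  + rewrite -pure11 -(sA i) (big_morph (fun a => pure a (1 : B)) (id1 := 0)
      (op1 := +%R)) ?pure0l //; last by move=> *; rewrite pureDl.
    by apply: eq_bigr => a _; rewrite star_pure star1 pureM mulr1.
  + rewrite -pure11 -(sB j) (big_morph (fun a => pure (1 : A) a) (id1 := 0)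
      (op1 := +%R)) ?pure0r //; last by move=> *; rewrite pureDr.
    by apply: eq_bigr => a _; rewrite star_pure star1 pureM mulr1.
  + by rewrite eeA.
  + by rewrite eeB.
  + by rewrite ssA.
  + by rewrite ssB.
  + by rewrite esA.
  + by rewrite esB.
- move=> P Pc Pg Ps PD PM; apply: tensor_ind => // a b.
  rewrite -[a]mulr1 -[b]mul1r -pureM; apply (PM).
    elim/indA: a => [r|i c|i c|x y Px Py|x y Px Py].
    + exact: (Pc r).
    + exact: (Pg (inl i)).
    + by have := Ps (inl i) c; rewrite /= star_pure star1.
    + by rewrite pureDl; exact: PD.
    + by rewrite -[1 : B]mulr1 -pureM; exact: PM.
  elim/indB: b => [r|i c|i c|x y Px Py|x y Px Py].
  + by rewrite -[ofbase r]mulr1 -pureZ mulr1; exact: (Pc r).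
  + exact: (Pg (inr i)).
  + by have := Ps (inr i) c; rewrite /= star_pure star1.
  + by rewrite pureDr; exact: PD.
  + by rewrite -[1 : A]mulr1 -pureM; exact: PM.
- move=> D e es [oD sD eeD ssD esD].
  have [f [[fD fM fC] fE]] : exists f : A -> D, is_alghom f /\ forall i a,
      f (gA i a) = e (inl i) a /\ f (star (gA i a)) = es (inl i) a.
    apply: univA; split=> [i a b|i|i j a b ij|i j a b ij|i j a b ij].
    + exact: (oD (inl i)).
    + exact: (sD (inl i)).
    + exact: (eeD (inl i) (inl j)).
    + exact: (ssD (inl i) (inl j)).
    + exact: (esD (inl i) (inl j)).
  have [h [[hD hM hC] hE]] : exists f : B -> D, is_alghom f /\ forall i a,
      f (gB i a) = e (inr i) a /\ f (star (gB i a)) = es (inr i) a.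
    apply: univB; split=> [i a b|i|i j a b ij|i j a b ij|i j a b ij].
    + exact: (oD (inr i)).
    + exact: (sD (inr i)).
    + exact: (eeD (inr i) (inr j)).
    + exact: (ssD (inr i) (inr j)).
    + exact: (esD (inr i) (inr j)).
  have f1 : f 1 = 1 by rewrite -(ofbase1 (s := A)) fC ofbase1.
  have h1 : h 1 = 1 by rewrite -(ofbase1 (s := B)) hC ofbase1.
  have gen_comm (x : D) : (forall i a, x * e (inr i) a = e (inr i) a * x) ->
      (forall i a, x * es (inr i) a = es (inr i) a * x) ->
      forall b, x * h b = h b * x.
    move=> xe xes; elim/indB => [r|i c|i c|y z IHy IHz|y z IHy IHz].
    + by rewrite hC ofbaseC.
    + by rewrite (hE i c).1.
    + by rewrite (hE i c).2.
    + by rewrite hD mulrDl mulrDr IHy IHz.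
    + by rewrite hM mulrA IHy -mulrA IHz mulrA.
  have fh a b : f a * h b = h b * f a.
    elim/indA: a b => [r|i c|i c|y z IHy IHz|y z IHy IHz] b.
    + by rewrite fC ofbaseC.
    + rewrite (fE i c).1; apply: gen_comm => j d.
        exact: (eeD (inl i) (inr j)).
      exact: (esD (inl i) (inr j)).
    + rewrite (fE i c).2; apply: gen_comm => j d.
        by rewrite (esD (inr j) (inl i)).
      exact: (ssD (inl i) (inr j)).
    + by rewrite fD mulrDl mulrDr IHy IHz.
    + by rewrite fM -mulrA IHz mulrA IHy mulrA.
  have bal : balanced (fun a b => f a * h b).
    split=> [a a' b|a b b'|r a b].
    + by rewrite fD mulrDl.
    + by rewrite hD mulrDr.
    + by rewrite fM hM fC hC ofbaseC mulrA.
  exists (tlift (fun a b => f a * h b)); split; first split.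
  + exact: tliftD.
  + move=> u v; elim/tensor_ind: u => [a b|u u' IH IH']; last first.
      by rewrite mulrDl !tliftD // mulrDl IH IH'.
    elim/tensor_ind: v => [c d|u u' IH IH']; last first.
      by rewrite mulrDr !tliftD // mulrDr IH IH'.
    by rewrite pureM !tlift_pure // fM hM -!mulrA; congr (_ * _);
      rewrite !mulrA fh.
  + by move=> r; rewrite [ofbase r]/(pure _ _) tlift_pure // fC h1 mulr1.
  + case=> i c /=; rewrite star_pure star1 !tlift_pure // ?f1 ?h1 ?mulr1 ?mul1r.
      exact: fE.
    exact: hE.
Qed.
End SumSystem.

(** Indices form a nested sum type, so only the multiset of arities is tracked; sortedness recovers
    the tuple at the end. *)
Lemma leavitt_tensor_multi_leavitt (R : comStarRingType) p ps :
  exists (I : finType) (n : I -> nat) g,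
    @multi_leavitt R I n
      (leavitt_tensor R [seq q.+1 | q <- p :: ps]) g /\
    perm_eq (codom n) (p :: ps).
Proof.
suff [I [n [g [mlg cn]]]] : exists (I : finType) (n : I -> nat) g,
    @multi_leavitt R I n (leavitt_tensor R [seq q.+1 | q <- p :: ps]) g /\
    forall v, (\sum_i (n i == v))%N = count_mem v (p :: ps).
  exists I, n, g; split=> //; apply/allP => v _ /=; apply/eqP.
  rewrite -[RHS]cn count_map -sum1_count big_enum_cond big_mkcond /=.
  by apply: eq_bigr => i _; case: (n i == v).
elim: ps p => [|q ps IH] p.
  exists unit, (fun=> p), (fun _ a => lgen R a); split.
    exact: multi_leavitt_unit.
  by move=> v; rewrite (big_pred1 tt) /= ?addn0 // => -[].
have [J [m [gB [mlB cB]]]] := IH q.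
exists (unit + J)%type, (sum_arity (fun=> p) m).
eexists; split.
  exact: (multi_leavitt_tensor (multi_leavitt_unit R p) mlB).
move=> v; rewrite big_sumType /= cB (big_pred1 tt) //.
Qed.

(** * The action on functions of points *)

Section Operators.
Variables (C : comPzRingType) (X : Type).

(** Linearity is bundled because right distributivity of composition over addition depends on it. *)
Record linop := Linop {
  linop_fun :> (X -> C) -> X -> C;
  linopP : forall c f g x,
    linop_fun (fun y => c * f y + g y) x = c * linop_fun f x + linop_fun g x }.

HB.instance Definition _ := gen_eqMixin linop.
HB.instance Definition _ := gen_choiceMixin linop.

Lemma linop_ext (F G : linop) : (forall f x, F f x = G f x) -> F = G.
Proof.
case: F G => [F FP] [G GP] /= FG.
have E : F = G by apply/funext => f; apply/funext => x.
by rewrite E in FP FG *; rewrite (Prop_irrelevance FP GP).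
Qed.

Fact linop_addP (F G : linop) c f g x :
  F (fun y => c * f y + g y) x + G (fun y => c * f y + g y) x =
  c * (F f x + G f x) + (F g x + G g x).
Proof. by rewrite !linopP mulrDr addrACA. Qed.
Fact linop_oppP (F : linop) c f g x :
  - F (fun y => c * f y + g y) x = c * - F f x + - F g x.
Proof. by rewrite linopP opprD mulrN. Qed.
Fact linop_zeroP (c : C) (f g : X -> C) (x : X) : 0 = c * 0 + 0 :> C.
Proof. by rewrite mulr0 addr0. Qed.
Fact linop_compP (F G : linop) c f g x :
  F (G (fun y => c * f y + g y)) x = c * F (G f) x + F (G g) x.
Proof.
rewrite -linopP; congr (linop_fun F _ x); apply/funext => y; exact: linopP.
Qed.
Fact linop_scaleP (r c : C) (f g : X -> C) x :
  r * (c * f x + g x) = c * (r * f x) + r * g x.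
Proof. by rewrite mulrDr mulrCA. Qed.

Definition linop_add F G := Linop (linop_addP F G).
Definition linop_opp F := Linop (linop_oppP F).
Definition linop_zero := Linop linop_zeroP.
Definition linop_comp F G := Linop (linop_compP F G).
Definition linop_scale r := Linop (linop_scaleP r).
Definition linop_one := @Linop id (fun _ _ _ _ => erefl).

Fact linop_addA : associative linop_add.
Proof. by move=> F G H; apply: linop_ext => f x /=; rewrite addrA. Qed.
Fact linop_addC : commutative linop_add.
Proof. by move=> F G; apply: linop_ext => f x /=; rewrite addrC. Qed.
Fact linop_add0 : left_id linop_zero linop_add.
Proof. by move=> F; apply: linop_ext => f x /=; rewrite add0r. Qed.
Fact linop_addN : left_inverse linop_zero linop_opp linop_add.
Proof. by move=> F; apply: linop_ext => f x /=; rewrite addNr. Qed.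
HB.instance Definition _ :=
  GRing.isZmodule.Build linop linop_addA linop_addC linop_add0 linop_addN.

Fact linop_compA : associative linop_comp.
Proof. by move=> F G H; apply: linop_ext. Qed.
Fact linop_comp1 : left_id linop_one linop_comp.
Proof. by move=> F; apply: linop_ext. Qed.
Fact linop_compr1 : right_id linop_one linop_comp.
Proof. by move=> F; apply: linop_ext. Qed.
Fact linop_compDl : left_distributive linop_comp linop_add.
Proof. by move=> F G H; apply: linop_ext. Qed.
Fact linop_compDr : right_distributive linop_comp linop_add.
Proof.
move=> F G H; apply: linop_ext => f x /=.
have := linopP F 1 (G f) (H f) x; rewrite mul1r => <-.
by congr (linop_fun F _ x); apply/funext => y; rewrite mul1r.
Qed.
HB.instance Definition _ := GRing.Zmodule_isPzRing.Build linop linop_compA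
  linop_comp1 linop_compr1 linop_compDl linop_compDr.
End Operators.

(* The phantom argument [S] selects the ring of scalars of the algebra. *)
Definition sub_linop (K : realType) (S : starSubring K) (X : Type) :=
  linop K[i] X.

Section SubringOperators.
Variables (K : realType) (S : starSubring K) (X : Type).
Local Notation R := (subring_type S).

Local Notation sub_linop := (sub_linop S X).
HB.instance Definition _ := GRing.PzRing.copy sub_linop (linop K[i] X).

Definition sub_linop_base (r : R) : sub_linop := linop_scale X (val r).
Fact sub_linop_baseD : {morph sub_linop_base : r s / r + s}.
Proof. by move=> r s; apply: linop_ext => f x /=; rewrite mulrDl. Qed.
Fact sub_linop_baseM : {morph sub_linop_base : r s / r * s}.
Proof. by move=> r s; apply: linop_ext => f x /=; rewrite mulrA. Qed.
Fact sub_linop_base1 : sub_linop_base 1 = 1.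
Proof. by apply: linop_ext => f x /=; rewrite mul1r. Qed.
Fact sub_linop_baseC r (F : sub_linop) :
  sub_linop_base r * F = F * sub_linop_base r.
Proof.
apply: linop_ext => f x /=.
have F0 : linop_fun F (fun=> 0) x = 0.
  have := linopP F (-1) (fun=> 0) (fun=> 0) x.
  rewrite (mulN1r (linop_fun F _ x)) (addNr (linop_fun F _ x)) => E.
  rewrite -[RHS]E; congr (linop_fun F _ x).
  by apply/funext => y; rewrite mulr0 addr0.
rewrite -[LHS]addr0 -F0 -linopP; congr (linop_fun F _ x).
by apply/funext => y; rewrite addr0.
Qed.
HB.instance Definition _ := PzRing_isAlg.Build R sub_linop
  sub_linop_baseD sub_linop_baseM sub_linop_base1 sub_linop_baseC.
End SubringOperators.

(** * Tuples of infinite words *)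

Section Points.
Variables (I : finType) (n : I -> nat).

Definition pt := forall i : I, nat -> 'I_(n i).+1.
HB.instance Definition _ := gen_eqMixin pt.
HB.instance Definition _ := gen_choiceMixin pt.

Definition scons (T : Type) (a : T) (s : nat -> T) (t : nat) : T :=
  if t is t'.+1 then s t' else a.

Definition pupd i (u : (nat -> 'I_(n i).+1) -> nat -> 'I_(n i).+1) (x : pt) :
  pt := dfwith x (u (x i)).
Definition pcons i a : pt -> pt := @pupd i (scons a).
Definition ptail i : pt -> pt := @pupd i (fun s t => s t.+1).

Lemma pupd_in i u x : pupd (i := i) u x i = u (x i).
Proof. exact: dfwith_in. Qed.
Lemma pupd_out i u x j : i != j -> pupd (i := i) u x j = x j.
Proof. exact: dfwith_out. Qed.

Lemma pcons_in i a x : pcons (i := i) a x i = scons a (x i).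
Proof. exact: dfwith_in. Qed.
Lemma pcons_out i a x j : i != j -> pcons (i := i) a x j = x j.
Proof. exact: dfwith_out. Qed.
Lemma ptail_in i x : ptail i x i = fun t => x i t.+1.
Proof. exact: dfwith_in. Qed.
Lemma ptail_out i x j : i != j -> ptail i x j = x j.
Proof. exact: dfwith_out. Qed.

Lemma pt_ext (x y : pt) : (forall i t, x i t = y i t) -> x = y.
Proof.
move=> xy; apply: functional_extensionality_dep => i; apply/funext; exact: xy.
Qed.

Lemma pupd_comm i j u v x : i != j ->
  pupd (i := i) u (pupd (i := j) v x) = pupd v (pupd u x).
Proof.
move=> ij; have ji : j != i by rewrite eq_sym.
apply: functional_extensionality_dep => k.
have [ik|ik] := eqVneq i k.
  by case: k / ik; rewrite pupd_in !(pupd_out _ _ ji) pupd_in.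
have [jk|jk] := eqVneq j k; last by rewrite !pupd_out.
by case: k / jk ik => _; rewrite pupd_in !(pupd_out _ _ ij) pupd_in.
Qed.

Lemma ptailK i (x : pt) : pcons (x i 0%N) (ptail i x) = x.
Proof.
apply: functional_extensionality_dep => j.
have [ij|ij] := eqVneq i j; last by rewrite pcons_out ?ptail_out.
by case: j / ij; rewrite pcons_in ptail_in; apply/funext => -[].
Qed.

Lemma pcons0 i a (x : pt) : pcons (i := i) a x i 0%N = a.
Proof. by rewrite pcons_in. Qed.

Lemma pconsK i a : cancel (@pcons i a) (ptail i).
Proof.
move=> x; apply: functional_extensionality_dep => j.
have [ij|ij] := eqVneq i j; last by rewrite ptail_out ?pcons_out.
by case: j / ij; rewrite ptail_in pcons_in.
Qed.
End Points.

Section PointRepresentation.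
Variables (K : realType) (S : starSubring K) (I : finType) (n : I -> nat).
Local Notation R := (subring_type S).
Local Notation C := K[i].
Local Notation X := (pt n).

Definition gen_fun i (a : 'I_(n i).+1) (f : X -> C) : X -> C :=
  fun x => if x i 0%N == a then f (ptail i x) else 0.
Definition genS_fun i (a : 'I_(n i).+1) (f : X -> C) : X -> C :=
  fun x => f (pcons a x).

Fact gen_funP i a (c : C) f g x :
  gen_fun (i := i) a (fun y => c * f y + g y) x =
  c * gen_fun a f x + gen_fun a g x.
Proof. by rewrite /gen_fun; case: ifP => // _; rewrite mulr0 addr0. Qed.

Definition gen_op i a : sub_linop S X := Linop (@gen_funP i a).
Definition genS_op i (a : 'I_(n i).+1) : sub_linop S X :=
  @Linop C X (genS_fun a) (fun _ _ _ _ => erefl).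

Lemma linop_sumE (T : finType) (F : T -> sub_linop S X) f x :
  linop_fun (\sum_a F a) f x = \sum_a linop_fun (F a) f x.
Proof. by elim/big_rec2: _ => // a G z _ <-. Qed.

Lemma op_rel : multi_leavitt_rel gen_op genS_op.
Proof.
split=> [i a b|i|i j a b ij|i j a b ij|i j a b ij]; apply: linop_ext => f x.
- rewrite /= /genS_fun /gen_fun pcons0 pconsK.
  by case: eqP.
- rewrite linop_sumE (bigD1 (x i 0%N)) //= big1 ?addr0.
    by rewrite /gen_fun /genS_fun eqxx ptailK.
  by move=> a; rewrite /gen_fun eq_sym => /negPf ->.
- have ji : j != i by rewrite eq_sym.
  rewrite /= /gen_fun !ptail_out // /ptail. rewrite (pupd_comm _ _ _ ij).
  by case: ifP; case: ifP.
- by rewrite /= /genS_fun /pcons (pupd_comm _ _ _ ij).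
- rewrite /= /genS_fun /gen_fun pcons_out 1?eq_sym //.
  by case: ifP => // _; rewrite /ptail /pcons (pupd_comm _ _ _ ij).
Qed.

(* [A] acts on functions on [pt n]; the generator [g i a] maps the indicator  *)
(* function of [x] to that of [pcons a x].                                    *)
Record point_rep (A : starAlgType R) (g : forall i, 'I_(n i).+1 -> A)
    (rho : A -> (X -> C) -> X -> C) : Prop := {
  rho_lin : forall u c f g x,
    rho u (fun y => c * f y + g y) x = c * rho u f x + rho u g x;
  rhoD : forall u v f x, rho (u + v) f x = rho u f x + rho v f x;
  rhoM : forall u v f, rho (u * v) f = rho u (rho v f);
  rho_base : forall r f x, rho (ofbase r) f x = val r * f x;
  rho_gen : forall i a f x,
    rho (g i a) f x = if x i 0%N == a then f (ptail i x) else 0;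
  rho_genS : forall i a f x, rho (star (g i a)) f x = f (pcons a x) }.

Lemma point_rep_exists (A : starAlgType R) (g : forall i, 'I_(n i).+1 -> A) :
  multi_leavitt g -> exists rho, point_rep g rho.
Proof.
move=> [_ _ /(_ _ _ _ op_rel)[F [[FD FM FC] FE]]].
exists (fun u => linop_fun (F u)); split.
- by move=> u c f h x; exact: linopP.
- by move=> u v f x; rewrite FD.
- by move=> u v f; rewrite FM.
- by move=> r f x; rewrite FC.
- by move=> i a f x; rewrite (FE i a).1.
- by move=> i a f x; rewrite (FE i a).2.
Qed.
End PointRepresentation.

(** * Partial isometries over kind rings *)

Definition idem (A : pzRingType) (p : A) := p * p = p.
Definition proj (A : starRingType) (p : A) := star p = p /\ idem p.
Definition pisom (A : starRingType) (v : A) := idem (star v * v).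

Lemma proj_pisom (A : starRingType) (p : A) : proj p -> pisom p.
Proof. by case=> ps pp; rewrite /pisom /idem ps !pp. Qed.

Lemma pisom_proj (A : starRingType) (v : A) : pisom v -> proj (star v * v).
Proof. by move=> vv; split=> //; rewrite starM starK. Qed.

Lemma proj1B (A : starRingType) (p : A) : proj p -> proj (1 - p).
Proof.
case=> ps pp; split; first by rewrite starD starN star1 ps.
by rewrite /idem mulrBl mul1r mulrBr mulr1 pp subrr subr0.
Qed.

Section Kernel.
Variables (K : realType) (S : starSubring K) (I : finType) (n : I -> nat).
Local Notation R := (subring_type S).
Local Notation C := K[i].
Local Notation X := (pt n).
Variables (A : starAlgType R) (g : forall i, 'I_(n i).+1 -> A).
Arguments g : clear implicits.
Variables (mlA : multi_leavitt g) (rho : A -> (X -> C) -> X -> C).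
Hypothesis rhoA : point_rep g rho.

Definition delta (x : X) : X -> C := fun y => (y == x)%:R.
(** The matrix entry of [u] in row [y] and column [x]. *)
Definition kap (u : A) (y x : X) : C := rho u (delta x) y.

Lemma rho0 u x : rho u (fun=> 0) x = 0.
Proof.
have := rho_lin rhoA u (-1) (fun=> 0) (fun=> 0) x.
rewrite (mulN1r (rho u _ x)) (addNr (rho u _ x)) => E; rewrite -[RHS]E.
by congr (rho u _ x); apply/funext => y; rewrite mulr0 addr0.
Qed.

Lemma rhoZ u c f x : rho u (fun y => c * f y) x = c * rho u f x.
Proof.
rewrite -[RHS]addr0 -[X in _ + X](rho0 u x) -(rho_lin rhoA).
by congr (rho u _ x); apply/funext => y; rewrite addr0.
Qed.

Lemma rho_sum u (T : Type) (L : seq T) (c : T -> C) (F : T -> X -> C) x :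
  rho u (fun y => \sum_(z <- L) c z * F z y) x =
  \sum_(z <- L) c z * rho u (F z) x.
Proof.
elim: L => [|z L IH].
  by rewrite big_nil -[RHS](rho0 u x); congr (rho u _ x);
    apply/funext => y; rewrite big_nil.
rewrite big_cons -IH -(rho_lin rhoA); congr (rho u _ x).
by apply/funext => y; rewrite big_cons.
Qed.

Lemma sum_delta (L : seq X) (f : X -> C) y : uniq L ->
  \sum_(z <- L) f z * delta z y = if y \in L then f y else 0.
Proof.
move=> uL; case: ifPn => yL.
  rewrite (bigD1_seq y) //= /delta eqxx mulr1 big1 ?addr0 // => z zy.
  by rewrite eq_sym (negPf zy) mulr0.
rewrite big1_seq // => z /= zL; rewrite /delta.
by case: eqP yL => [->|_ _]; rewrite ?zL ?mulr0.
Qed.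

Lemma rho_decomp u (f : X -> C) (L : seq X) y : uniq L ->
  (forall z, f z != 0 -> z \in L) ->
  rho u f y = \sum_(z <- L) f z * kap u y z.
Proof.
move=> uL fL; rewrite -rho_sum; congr (rho u _ y); apply/funext => z.
rewrite sum_delta //; case: ifPn => // zL.
by apply/eqP; apply: contraNT zL => /fL.
Qed.

Definition finsupp (f : X -> C) (L : seq X) := forall z, f z != 0 -> z \in L.

(** Matrix columns are therefore finite, which makes the product formula [kapM] a finite sum. *)
Lemma rho_finsupp u f L : finsupp f L -> exists L', finsupp (rho u f) L'.
Proof.
elim/(ml_ind mlA): u f L => [r|i a|i a|u v IHu IHv|u v IHu IHv] f L fL.
- exists L => z; rewrite (rho_base rhoA) mulf_eq0 negb_or => /andP[_]; exact: fL.
- exists [seq pcons a x | x <- L] => z; rewrite (rho_gen rhoA).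
  case: ifP => [/eqP <- /fL zL|_]; last by rewrite eqxx.
  by rewrite -[z in z \in _](ptailK i); apply: map_f.
- exists [seq ptail i x | x <- L] => z; rewrite (rho_genS rhoA) => /fL zL.
  by rewrite -[z](pconsK a); exact: map_f.
- have [[L1 uL] [L2 vL]] := (IHu f L fL, IHv f L fL).
  exists (L1 ++ L2) => z; rewrite (rhoD rhoA) mem_cat.
  have [u0|/uL-> //] := eqVneq (rho u f z) 0.
  by rewrite u0 add0r => /vL ->; rewrite orbT.
- have [L1 vL] := IHv f L fL; have [L2 uL] := IHu _ _ vL.
  by exists L2 => z; rewrite (rhoM rhoA); exact: uL.
Qed.

Lemma delta_finsupp x : finsupp (delta x) [:: x].
Proof. by move=> y; rewrite /delta inE; case: (y == x); rewrite ?eqxx. Qed.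

Lemma kap_finsupp u x : exists L, finsupp (fun y => kap u y x) L.
Proof. exact: (rho_finsupp u (@delta_finsupp x)). Qed.

Lemma kapD u v y x : kap (u + v) y x = kap u y x + kap v y x.
Proof. exact: (rhoD rhoA). Qed.

Lemma kapM u v L x y : uniq L -> finsupp (fun z => kap v z x) L ->
  kap (u * v) y x = \sum_(z <- L) kap v z x * kap u y z.
Proof. by move=> uL vL; rewrite /kap (rhoM rhoA) (rho_decomp _ _ uL). Qed.

Lemma rho_in_S u f : (forall x, f x \in S) -> forall x, rho u f x \in S.
Proof.
elim/(ml_ind mlA): u f => [r|i a|i a|u v IHu IHv|u v IHu IHv] f fS x.
- by rewrite (rho_base rhoA) rpredM ?(valP r).
- by rewrite (rho_gen rhoA); case: ifP; rewrite ?rpred0.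
- by rewrite (rho_genS rhoA).
- by rewrite (rhoD rhoA) rpredD ?IHu ?IHv.
- by rewrite (rhoM rhoA); apply: IHu; apply: IHv.
Qed.

Lemma kap_in_S u y x : kap u y x \in S.
Proof.
by apply: rho_in_S => z; rewrite /delta; case: eqP; rewrite ?rpred0 ?rpred1.
Qed.

Lemma conjc_nat (b : bool) : conjc (b%:R : C) = b%:R.
Proof. by case: b; rewrite ?rmorph1 ?rmorph0. Qed.

Lemma pcons_eq i (a : 'I_(n i).+1) (x y : X) :
  (pcons a x == y) = (y i 0%N == a) && (ptail i y == x).
Proof.
apply/eqP/andP => [<-|[/eqP <- /eqP <-]]; last by rewrite ptailK.
by rewrite pcons0 pconsK !eqxx.
Qed.

Lemma kap_gen i a y x : kap (g i a) y x = (pcons a x == y)%:R.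
Proof.
rewrite /kap (rho_gen rhoA) pcons_eq /delta.
by case: ifP.
Qed.

Lemma kap_genS i a y x : kap (star (g i a)) y x = (pcons a y == x)%:R.
Proof. by rewrite /kap (rho_genS rhoA). Qed.

Lemma kap_star u x y : kap (star u) x y = conjc (kap u y x).
Proof.
elim/(ml_ind mlA): u x y => [r|i a|i a|u v IHu IHv|u v IHu IHv] x y.
- rewrite star_ofbase /kap !(rho_base rhoA) rmorphM /= /delta conjc_nat.
  by rewrite eq_sym.
- by rewrite kap_genS kap_gen conjc_nat.
- by rewrite starK kap_genS kap_gen conjc_nat.
- by rewrite starD !kapD rmorphD /= IHu IHv.
- have [L1 L1P] := kap_finsupp v x; have [L2 L2P] := kap_finsupp (star u) y.
  pose L := undup (L1 ++ L2).
  rewrite starM [LHS](@kapM _ _ L) ?undup_uniq //; last first.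
    by move=> z /L2P zL; rewrite mem_undup mem_cat zL orbT.
  rewrite (@kapM _ _ L) ?undup_uniq //; last first.
    by move=> z /L1P zL; rewrite mem_undup mem_cat zL.
  rewrite rmorph_sum; apply: eq_bigr => z _.
  by rewrite rmorphM IHu IHv mulrC.
Qed.

Lemma kap_starM v L x : uniq L -> finsupp (fun z => kap v z x) L ->
  kap (star v * v) x x = \sum_(z <- L) `|kap v z x| ^+ 2.
Proof.
move=> uL vL; rewrite (kapM _ _ uL vL); apply: eq_bigr => z _.
by rewrite kap_star -sqr_normc.
Qed.

Hypothesis kindS : kind S.

Lemma kind_sum (L : seq X) (c : X -> C) x0 : uniq L -> x0 \in L ->
  (forall x, c x \in S) -> c x0 = \sum_(x <- L) `|c x| ^+ 2 ->
  forall x, x != x0 -> x \in L -> c x = 0.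
Proof.
move=> uL x0L cS cE x xx0 xL.
apply: (kindS (z := c x0) (s := [seq c y | y <- L & y != x0])) => //.
- by move=> w /mapP[y _ ->].
- by rewrite [LHS]cE (bigD1_seq x0) //= big_map big_filter.
- by apply: map_f; rewrite mem_filter xx0.
Qed.

(** The diagonal entry of [star p * p = p] is the sum of the squared moduli of column [x], itself
    included. This is exactly the equation to which kindness applies. *)
Lemma proj_off p x y : proj p -> y != x -> kap p y x = 0.
Proof.
move=> [ps pp] yx; have [L LP] := kap_finsupp p x.
pose L' := undup (x :: L).
have L'P : finsupp ((kap p)^~ x) L'.
  by move=> z /LP zL; rewrite mem_undup inE zL orbT.
have [yL|yL] := boolP (y \in L'); last first.
  by apply/eqP; apply: contraNT yL => /L'P.
apply: (kind_sum (L := L') (x0 := x) (c := (kap p)^~ x)) => //.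
- exact: undup_uniq.
- by rewrite mem_undup mem_head.
- by move=> z; exact: kap_in_S.
by rewrite -kap_starM ?undup_uniq // ps pp.
Qed.

Definition inP p x := kap p x x != 0.

Lemma proj_diag p x : proj p ->
  rho p (delta x) = fun y => (inP p x)%:R * delta x y.
Proof.
move=> pP; apply/funext => y; rewrite -/(kap p y x) /delta.
have [->|yx] := eqVneq y x; last by rewrite (proj_off pP yx) mulr0.
rewrite mulr1 /inP.
have : kap p x x = kap p x x * kap p x x.
  rewrite -{1}pP.2 (@kapM _ _ [:: x]) ?big_seq1 // => z.
  by rewrite inE; apply: contraNT => zx; rewrite (proj_off pP zx).
have [-> //|k0] := eqVneq (kap p x x) 0.
move=> /esym/eqP; rewrite -subr_eq0 -[X in _ - X]mulr1 -mulrBr mulf_eq0.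
by rewrite (negPf k0) subr_eq0 => /eqP.
Qed.

(** The squared norm of column [x] is a diagonal entry of the projection [star v * v], hence 0 or 1.
    In the second case kindness leaves a single entry, of modulus 1. *)
Lemma pisom_delta v x : pisom v -> (forall y, kap v y x = 0) \/
  exists y c, c * conjc c = 1 /\ rho v (delta x) = fun z => c * delta y z.
Proof.
move=> vP; have [L0 L0P] := kap_finsupp v x; pose L := undup L0.
have uL : uniq L by exact: undup_uniq.
have LP : finsupp ((kap v)^~ x) L by move=> z /L0P; rewrite mem_undup.
have vE := kap_starM uL LP.
have ge0 z : 0 <= `|kap v z x| ^+ 2 by rewrite exprn_ge0.
have [/hasP[y yL yv]|/hasPn v0] := boolP (has (fun y => kap v y x != 0) L);
    last first.
  left=> y; apply/eqP; apply: contraT => vy.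
  by have := v0 y (LP y vy); rewrite vy.
right; exists y, (kap v y x).
have v1 : \sum_(z <- L) `|kap v z x| ^+ 2 = 1.
  rewrite -vE /kap (proj_diag _ (pisom_proj vP)) /delta eqxx mulr1.
  suff -> : inP (star v * v) x by [].
  rewrite /inP vE; apply: contraNneq yv => /eqP.
  rewrite psumr_eq0 // => /allP/(_ y yL) /=.
  by rewrite expf_eq0 normr_eq0 /=.
(* Since the column has norm 1, this rescaling makes the entry at [y] equal to the sum of all
   squared moduli, as kindness requires. *)
pose d z := kap v y x * conjc (kap v z x).
have dS z : d z \in S by rewrite rpredM ?kap_in_S // conj_closed ?kap_in_S.
have dy : d y = \sum_(z <- L) `|d z| ^+ 2.
  rewrite {1}/d -sqr_normc -[LHS]mulr1 -[X in _ * X]v1 mulr_sumr.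
  by apply: eq_bigr => z _; rewrite /d !sqr_normc rmorphM /= conjcK; ring.
have off z : z != y -> kap v z x = 0.
  move=> zy; apply/eqP; apply: contraT => vz.
  have := kind_sum uL yL dS dy zy (LP z vz).
  move/eqP; rewrite mulf_eq0 (negPf yv) /= => /eqP cz.
  by rewrite -[kap v z x]conjcK cz rmorph0 eqxx in vz.
split.
  rewrite -sqr_normc -v1 (bigD1_seq y) //= big1_seq ?addr0 // => z /andP[zy _].
  by rewrite off // normr0 expr0n.
apply/funext => z; rewrite -/(kap v z x) /delta.
by have [->|/off ->] := eqVneq z y; rewrite ?mulr1 ?mulr0.
Qed.

(** For a partial isometry this is the graph of a partial map ([sends_uniq]), whose domain is the
    projection [star v * v] ([sends_dom]). *)
Definition sends v x y := kap v y x != 0.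

Lemma sends_delta v x y : pisom v -> sends v x y ->
  exists c, [/\ c != 0, c * conjc c = 1 &
    rho v (delta x) = fun z => c * delta y z].
Proof.
move=> vP vxy; case: (pisom_delta x vP) => [v0|[y' [c [c1 vE]]]].
  by rewrite /sends v0 eqxx in vxy.
have yy' : y = y'.
  by apply: contraNeq vxy => yy'; rewrite /kap vE /delta (negPf yy') mulr0.
subst y'; exists c; split=> //; apply: contraNneq vxy => c0.
by rewrite /kap vE c0 mul0r.
Qed.

Lemma sends_uniq v x y y' : pisom v -> sends v x y -> sends v x y' -> y = y'.
Proof.
move=> vP /(sends_delta vP)[c [_ _ vE]]; rewrite /sends /kap vE /delta.
by have [->|_] := eqVneq y' y; rewrite ?mulr0 ?eqxx.
Qed.

Lemma sends_dom v x : pisom v -> (exists y, sends v x y) <-> inP (star v * v) x.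
Proof.
move=> vP; case: (pisom_delta x vP) => [v0|[y [c [c1 vE]]]].
  split=> [[y]|]; first by rewrite /sends v0 eqxx.
  rewrite /inP /kap (rhoM rhoA).
  have -> : rho v (delta x) = fun=> 0 by apply/funext => y; exact: v0.
  by rewrite rho0 eqxx.
have c0 : c != 0 by apply: contra_eq_neq c1 => ->; rewrite mul0r eq_sym oner_neq0.
split=> [_|_]; last by exists y; rewrite /sends /kap vE /delta eqxx mulr1.
rewrite /inP (kap_starM (L := [:: y])) // ?big_seq1.
  by rewrite /kap vE /delta eqxx mulr1 sqr_normc c1 oner_neq0.
move=> z; rewrite /kap vE /delta inE.
by case: (z == y); rewrite // mulr0 eqxx.
Qed.

Lemma inP1B p x : proj p -> inP (1 - p) x = ~~ inP p x.
Proof.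
move=> pP; have k1 : kap 1 x x = 1.
  by rewrite /kap -(ofbase1 (s := A)) (rho_base rhoA) /delta eqxx mulr1.
have kp : kap p x x = (inP p x)%:R.
  by rewrite {1}/kap (proj_diag _ pP) /delta eqxx mulr1.
have kp' : kap (1 - p) x x = (inP (1 - p) x)%:R.
  by rewrite {1}/kap (proj_diag _ (proj1B pP)) /delta eqxx mulr1.
have : kap (1 - p) x x + kap p x x = 1 by rewrite -kapD subrK.
rewrite kp kp'; case: (inP p x); case: (inP _ x) => //=.
  by move=> /eqP; rewrite -subr_eq0 addrK oner_eq0.
by rewrite addr0 => /eqP; rewrite eq_sym oner_eq0.
Qed.
End Kernel.
Arguments delta {K I n} x y.

(** * Words and points *)

Section Words.
Variables (I : finType) (n : I -> nat).
Local Notation X := (pt n).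

Definition word := forall i : I, seq 'I_(n i).+1.
HB.instance Definition _ := gen_eqMixin word.
HB.instance Definition _ := gen_choiceMixin word.

Definition wnil : word := fun i => [::].
Definition wcons i a (w : word) : word := dfwith w (a :: w i).
Definition wapp (w w' : word) : word := fun i => w i ++ w' i.
Definition wact (w : word) (x : X) : X :=
  fun i t => nth (x i (t - size (w i))%N) (w i) t.
Definition deep N (w : word) := forall i, (N <= size (w i))%N.
Definition wpre N (x : X) : word := fun i => mkseq (x i) N.
Definition pdrop N (x : X) : X := fun i t => x i (t + N)%N.
Definition agree N (x y : X) := forall i t, (t < N)%N -> x i t = y i t.

Lemma wcons_in i a w : wcons (i := i) a w i = a :: w i.
Proof. exact: dfwith_in. Qed.
Lemma wcons_out i a w j : i != j -> wcons (i := i) a w j = w j.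
Proof. exact: dfwith_out. Qed.

Lemma word_ext (w w' : word) : (forall i, w i = w' i) -> w = w'.
Proof. by move=> ww; apply: functional_extensionality_dep. Qed.

Lemma word_ind (P : word -> Prop) : P wnil ->
  (forall i a w, P w -> P (wcons (i := i) a w)) -> forall w, P w.
Proof.
move=> P0 Pc w; have [k] := ubnP (\sum_i size (w i))%N.
elim: k w => // k IH w wk.
have [i wi|w0] := pickP (fun i => w i != [::]); last first.
  suff -> : w = wnil by [].
  by apply: word_ext => i; apply/eqP; rewrite -[_ == _]negbK w0.
case E : (w i) wi => [//|a s] _.
have -> : w = wcons a (dfwith w s).
  apply: word_ext => j; have [ij|ij] := eqVneq i j.
    by case: j / ij; rewrite wcons_in dfwith_in.
  by rewrite wcons_out // dfwith_out.
apply/Pc/IH; rewrite (bigD1 i) //= dfwith_in.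
rewrite (eq_bigr (fun j => size (w j))); last first.
  by move=> j ji; rewrite dfwith_out // eq_sym.
by move: wk; rewrite (bigD1 i) //= E /= addSn ltnS.
Qed.

Lemma wact_nil x : wact wnil x = x.
Proof. by apply: pt_ext => i t; rewrite /wact nth_default // subn0. Qed.

Lemma wact_cons i a w x : wact (wcons (i := i) a w) x = pcons a (wact w x).
Proof.
apply: pt_ext => j t; rewrite /wact; have [ij|ij] := eqVneq i j.
  case: j / ij; rewrite wcons_in pcons_in.
  by case: t => [|t].
by rewrite wcons_out // pcons_out.
Qed.

Lemma wapp_cons i a w w' : wapp (wcons (i := i) a w) w' = wcons a (wapp w w').
Proof.
apply: word_ext => j; rewrite /wapp; have [ij|ij] := eqVneq i j.
  by case: j / ij; rewrite !wcons_in.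
by rewrite !wcons_out.
Qed.

Lemma wact_lt w x i t (d : 'I_(n i).+1) : (t < size (w i))%N ->
  wact w x i t = nth d (w i) t.
Proof. by move=> tw; rewrite /wact (set_nth_default d). Qed.

Lemma wact_ge w x i t : wact w x i (size (w i) + t)%N = x i t.
Proof. by rewrite /wact nth_default ?leq_addr // addKn. Qed.

Lemma wpreK N x : wact (wpre N x) (pdrop N x) = x.
Proof.
apply: pt_ext => i t; rewrite /wact /wpre /pdrop size_mkseq.
have [tN|Nt] := ltnP t N; first by rewrite nth_mkseq.
by rewrite nth_default ?size_mkseq // subnK.
Qed.

Lemma wpre_agree N x y : agree N x y -> wpre N x = wpre N y.
Proof.
move=> xy; apply: word_ext => i; apply/eq_in_map => t; rewrite mem_iota => tN.
exact: xy.
Qed.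

Lemma agreeP N x y : agree N x y <-> exists z, y = wact (wpre N x) z.
Proof.
split=> [xy|[z ->] i t tN].
  by exists (pdrop N y); rewrite (wpre_agree xy) wpreK.
by rewrite (wact_lt _ (x i 0%N)) ?size_mkseq // nth_mkseq.
Qed.

Lemma deep_split N N' w : deep (N + N') w ->
  exists w1 w2, [/\ w = wapp w1 w2, deep N w1 & deep N' w2].
Proof.
move=> wd; exists (fun i => take N (w i)), (fun i => drop N (w i)); split.
- by apply: word_ext => i; rewrite /wapp cat_take_drop.
- by move=> i; rewrite size_take; have := wd i; case: ltnP; lia.
- by move=> i; rewrite size_drop; have := wd i; lia.
Qed.

(* The positions of the letter 1 are the powers of 2, whose gaps are          *)
(* unbounded, so no two distinct tails of this point agree.                   *)
Definition aperiodic_pt : X :=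
  fun i t => inord ((2 ^ trunc_log 2 t == t)%N : nat).

Hypothesis n_gt0 : forall i, (0 < n i)%N.

(** Position 2^d carries the letter 1, while 2^d + d lies strictly between two consecutive powers of
    2 and carries 0. *)
Lemma aperiodic_shift i d : (0 < d)%N ->
  ~ (forall t, aperiodic_pt i (t + d)%N = aperiodic_pt i t).
Proof.
move=> d0 /(_ (2 ^ d)%N) /(congr1 val).
have d2 : (d < 2 ^ d)%N by exact: ltn_expl.
rewrite /= !inordK ?ltnS; try by case: (_ == _) => //=; exact: n_gt0.
have -> : trunc_log 2 (2 ^ d + d) = d.
  by apply: trunc_log_eq => //; rewrite expnS; lia.
have -> : trunc_log 2 (2 ^ d) = d by rewrite trunc_expnK.
by rewrite eqxx -[X in (X == _)%N]addn0 eqn_add2l; case: d d0 {d2}.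
Qed.

(** Prefixes of different lengths would make the point agree with a proper shift of itself; once
    lengths agree, letters are compared one by one. *)
Lemma wact_aperiodic_inj w w' :
  wact w aperiodic_pt = wact w' aperiodic_pt -> w = w'.
Proof.
move=> ww; apply: word_ext => i.
have sz (v v' : word) : wact v aperiodic_pt = wact v' aperiodic_pt ->
    ~ (size (v i) < size (v' i))%N.
  move=> vv lt; apply: (@aperiodic_shift i (size (v' i) - size (v i))).
    by rewrite subn_gt0.
  move=> t; have := congr1 (fun x : X => x i (size (v' i) + t)%N) vv.
  rewrite wact_ge => <-; rewrite -(wact_ge v); congr (wact v _ i _).
  lia.
have sE : size (w i) = size (w' i).
  by have := sz _ _ ww; have := sz _ _ (esym ww); lia.
apply: (@eq_from_nth _ ord0) => // t tw.
by rewrite -(wact_lt aperiodic_pt) // ww (wact_lt _ ord0) -?sE.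
Qed.
End Words.

(** * Normal forms and faithfulness *)

Section Monomials.
Variables (R : comStarRingType) (I : finType) (n : I -> nat).
Variables (A : starAlgType R) (g : forall i, 'I_(n i).+1 -> A).
Arguments g : clear implicits.
Hypothesis mlA : multi_leavitt g.
Local Notation word := (word n).

Definition em (w : word) : A := \prod_(i <- enum I) \prod_(a <- w i) g i a.

Lemma em_nil : em (@wnil I n) = 1.
Proof. by rewrite /em big1 // => i _; rewrite big_nil. Qed.

Lemma em_cons i a w : em (wcons (i := i) a w) = g i a * em w.
Proof.
have rel := ml_rel mlA.
rewrite /em; have : i \in enum I by rewrite mem_enum.
have gprod j (s : seq 'I_(n j).+1) : i != j ->
    g i a * \prod_(b <- s) g j b = \prod_(b <- s) g j b * g i a.
  move=> ij; elim: s => [|b s IH]; first by rewrite !big_nil mul1r mulr1.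
  by rewrite !big_cons mulrA (mlr_ee rel a b ij) -[LHS]mulrA IH mulrA.
elim: (enum I) (enum_uniq I) => //= j s IH /andP[js us].
rewrite inE !big_cons; have [ij _|ij /= /(IH us) ->] := eqVneq i j.
  case: j / ij js => is_; rewrite wcons_in big_cons -mulrA; congr (_ * (_ * _)).
  apply: eq_big_seq => j js; rewrite wcons_out //.
  by apply: contraNneq is_ => ->.
by rewrite wcons_out // mulrA -gprod // mulrA.
Qed.

Lemma em_app w w' : em (wapp w w') = em w * em w'.
Proof.
elim/word_ind: w => [|i a w IH]; first by rewrite em_nil mul1r.
by rewrite wapp_cons !em_cons IH mulrA.
Qed.

Lemma em_ortho w : star (em w) * em w = 1.
Proof.
elim/word_ind: w => [|i a w IH]; first by rewrite em_nil star1 mulr1.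
rewrite em_cons starM -mulrA [star (g i a) * _]mulrA (mlr_ortho (ml_rel mlA)).
by rewrite eqxx mul1r.
Qed.

Definition spanned (u : A) :=
  exists s : seq (R * word), u = \sum_(p <- s) ofbase p.1 * em p.2.

Lemma spannedD u v : spanned u -> spanned v -> spanned (u + v).
Proof. by case=> s -> [s' ->]; exists (s ++ s'); rewrite big_cat. Qed.

Lemma spannedZ r u : spanned u -> spanned (ofbase r * u).
Proof.
case=> s ->; exists [seq (r * p.1, p.2) | p <- s].
rewrite big_map mulr_sumr; apply: eq_bigr => p _.
by rewrite ofbaseM mulrA.
Qed.

Lemma spanned0 : spanned 0.
Proof. by exists [::]; rewrite big_nil. Qed.

Lemma spanned_sum (T : Type) (s : seq T) (F : T -> A) :
  (forall p, spanned (F p)) -> spanned (\sum_(p <- s) F p).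
Proof.
move=> FP; elim: s => [|p s IH]; first by rewrite big_nil; exact: spanned0.
by rewrite big_cons; exact: spannedD.
Qed.

Lemma spanned_em w : spanned (em w).
Proof. by exists [:: (1, w)]; rewrite big_seq1 ofbase1 mul1r. Qed.

(** Each starred generator in [u] is absorbed by a letter of [w]. For a product, the first letters
    of [w] serve the right factor and the remaining ones the left factor. *)
Lemma spanned_deep u : exists N, forall w, deep N w -> spanned (u * em w).
Proof.
have rel := ml_rel mlA.
elim/(ml_ind mlA): u => [r|i a|i a|u v [N uN] [N' vN]|u v [N uN] [N' vN]].
- by exists 0%N => w _; apply/spannedZ/spanned_em.
- by exists 0%N => w _; rewrite -em_cons; exact: spanned_em.
- exists 1%N => w /(_ i); case E : (w i) => [//|b s] _.
  have -> : w = wcons b (dfwith w s).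
    apply: word_ext => j; have [ij|ij] := eqVneq i j.
      by case: j / ij; rewrite wcons_in dfwith_in.
    by rewrite wcons_out // dfwith_out.
  rewrite em_cons mulrA (mlr_ortho rel).
  case: eqP => _; first by rewrite mul1r; exact: spanned_em.
  by rewrite mul0r; exact: spanned0.
- exists (N + N')%N => w wd; rewrite mulrDl.
  by apply: spannedD; [apply: uN|apply: vN] => i; have := wd i; lia.
- exists (N' + N)%N => w /deep_split[w1 [w2 [-> w1d w2d]]].
  have [s sE] := vN _ w1d.
  rewrite em_app -mulrA [v * _]mulrA sE mulr_suml mulr_sumr.
  apply: spanned_sum => p; rewrite -mulrA -em_app mulrA -ofbaseC -mulrA.
  by apply/spannedZ/uN => i; rewrite size_cat; have := w2d i; lia.
Qed.

Lemma spanned_uniq u : spanned u ->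
  exists (L : seq word) (c : word -> R), uniq L /\
    u = \sum_(w <- L) ofbase (c w) * em w.
Proof.
case=> s ->; exists (undup [seq p.2 | p <- s]).
exists (fun w => \sum_(p <- s | p.2 == w) p.1); split; first exact: undup_uniq.
have ofsum (T : Type) (t : seq T) (P : pred T) (F : T -> R) :
    ofbase (\sum_(p <- t | P p) F p) = \sum_(p <- t | P p) ofbase (F p) :> A.
  by apply: big_morph; [exact: ofbaseD|exact: ofbase0].
under [RHS]eq_bigr => w _ do rewrite ofsum mulr_suml big_mkcond.
rewrite exchange_big; apply: eq_big_seq => p ps.
rewrite (bigD1_seq p.2) ?undup_uniq //=; last by rewrite mem_undup map_f.
rewrite eqxx big1 ?addr0 // => w.
by rewrite eq_sym => /negPf ->.
Qed.

(** The relation that the [g i a * star (g i a)] sum to 1 lets the vanishing for longer words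
    descend to shorter ones. *)
Lemma deep_cancel N u : (forall w, deep N w -> u * em w = 0) -> u = 0.
Proof.
have rel := ml_rel mlA.
have step v : (forall w, deep 1 w -> v * em w = 0) -> v = 0.
  (* Coordinates that must be nonempty are removed one at a time. *)
  pose H (s : seq I) := forall w : word,
    (forall i, i \in s -> 0 < size (w i))%N -> v * em w = 0.
  move=> v1; have : H (enum I) by move=> w wd; apply: v1 => i; rewrite wd ?mem_enum.
  suff H0 s : H s -> H [::].
    by move=> /H0/(_ (@wnil I n)); rewrite em_nil mulr1; apply.
  elim: s => // i s IH Hs; apply: IH => w wd.
  rewrite -[em w]mulr1 -(mlr_sum rel i) mulr_sumr mulr_sumr big1 // => a _.
  have -> : g i a = em (wcons a (@wnil I n)) by rewrite em_cons em_nil mulr1.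
  rewrite [em w * _]mulrA -em_app mulrA Hs ?mul0r // => j.
  rewrite inE size_cat; have [->|ji] := eqVneq j i.
    by rewrite wcons_in /= addn1.
  by move=> /wd; lia.
elim: N u => [|N IH] u uN; first by rewrite -[u]mulr1 -em_nil uN.
apply: IH => w wd; apply: step => w' wd'.
rewrite -mulrA -em_app uN // => i; rewrite size_cat.
by have := wd i; have := wd' i; lia.
Qed.
End Monomials.

Section NormalForm.
Variables (K : realType) (S : starSubring K) (I : finType) (n : I -> nat).
Local Notation R := (subring_type S).
Local Notation C := K[i].
Local Notation X := (pt n).
Variables (A : starAlgType R) (g : forall i, 'I_(n i).+1 -> A).
Arguments g : clear implicits.
Variables (mlA : multi_leavitt g) (rho : A -> (X -> C) -> X -> C).
Hypotheses (rhoA : point_rep g rho) (n_gt0 : forall i, (0 < n i)%N).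
Local Notation word := (word n).
Local Notation em := (em g).
Local Notation sends := (sends rho).
Local Notation inP := (inP rho).
Local Notation kap := (kap rho).
Local Notation z0 := (aperiodic_pt n).

Lemma rho_em w x : rho (em w) (delta x) = delta (wact w x).
Proof.
elim/word_ind: w => [|i a w IH].
  apply/funext => y; rewrite em_nil wact_nil -(ofbase1 (s := A)).
  by rewrite (rho_base rhoA) mul1r.
rewrite (em_cons mlA) (rhoM rhoA) IH wact_cons; apply/funext => y.
by rewrite -/(kap _ _ _) (kap_gen rhoA) /delta eq_sym.
Qed.

Lemma rho_mul_em u w x : rho (u * em w) (delta x) = rho u (delta (wact w x)).
Proof. by rewrite (rhoM rhoA) rho_em. Qed.

Lemma rho_ofbase_em r w x :
  rho (ofbase r * em w) (delta x) = fun y => val r * delta (wact w x) y.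
Proof.
by apply/funext => y; rewrite (rhoM rhoA) (rho_base rhoA) rho_em.
Qed.

(** Distinct words move the aperiodic point to distinct points, so coefficients can be read off. *)
Lemma normal_coef (L : seq word) (c : word -> R) w : uniq L -> w \in L ->
  rho (\sum_(v <- L) ofbase (c v) * em v) (delta z0) (wact w z0) = val (c w).
Proof.
move=> uL wL.
have rsum (s : seq word) y :
    rho (\sum_(v <- s) ofbase (c v) * em v) (delta z0) y =
    \sum_(v <- s) val (c v) * delta (wact v z0) y.
  elim: s => [|v s IH].
    by rewrite !big_nil -(ofbase0 (R := R)) (rho_base rhoA) mul0r.
  by rewrite !big_cons (rhoD rhoA) IH rho_ofbase_em.
rewrite rsum (bigD1_seq w) //= /delta eqxx mulr1 big1 ?addr0 // => v vw.
case: eqP => [/(wact_aperiodic_inj n_gt0) wv|_]; last by rewrite mulr0.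
by rewrite wv eqxx in vw.
Qed.

(** After multiplication by a deep monomial, [u] is a combination of distinct monomials whose
    coefficients all vanish by [normal_coef]. *)
Lemma rho_faithful u : (forall x, rho u (delta x) = fun=> 0) -> u = 0.
Proof.
move=> u0; have [N uN] := spanned_deep mlA u.
apply: (deep_cancel mlA (N := N)) => w /uN /spanned_uniq[L [c [uL uE]]].
rewrite uE big_seq big1 // => v vL.
have := normal_coef c uL vL; rewrite -uE rho_mul_em u0.
by move=> /esym c0; rewrite (_ : c v = 0) ?ofbase0 ?mul0r //; apply: val_inj.
Qed.

Lemma rho_inj u v : (forall x, rho u (delta x) = rho v (delta x)) -> u = v.
Proof.
move=> uv; apply/eqP; rewrite -subr_eq0; apply/eqP/rho_faithful => x.
apply/funext => y; rewrite -mulN1r -(ofbase1 (s := A)) -ofbaseN.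
by rewrite (rhoD rhoA) (rhoM rhoA) (rho_base rhoA) uv /= mulN1r subrr.
Qed.

Lemma diag_proj (D : X -> bool) p :
  (forall x, rho p (delta x) = fun y => (D x)%:R * delta x y) ->
  proj p /\ forall x, inP p x = D x.
Proof.
move=> pE; split.
  split; apply: rho_inj => x.
    apply/funext => y; rewrite -/(kap (star p) y x) (kap_star mlA rhoA) /kap !pE.
    rewrite rmorphM /= /delta !conjc_nat eq_sym.
    by have [->|] := eqVneq y x; rewrite ?mulr0.
  rewrite (rhoM rhoA) pE; apply/funext => y; rewrite (rhoZ rhoA) pE mulrA.
  by case: (D x); rewrite ?mul1r ?mul0r.
move=> x; rewrite /inP /kap pE /delta eqxx mulr1.
by rewrite pnatr_eq0 eqb0 negbK.
Qed.

(** The test on letter [t.+1] strips the first letter, applies the test on letter [t] and restores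
    it: a sum over [b] of conjugates by [g i b]. *)
Lemma letter_proj i t (a : 'I_(n i).+1) :
  exists q, proj q /\ forall x, inP q x = (x i t == a).
Proof.
suff [q qE] : exists q, forall f y, rho q f y = if y i t == a then f y else 0.
  exists q; apply: diag_proj => x; apply/funext => y; rewrite qE /delta.
  have [->|] := eqVneq y x; last by rewrite if_same mulr0.
  by case: ifP; rewrite ?mul1r ?mul0r.
have rel := ml_rel mlA.
elim: t => [|t [q qE]].
  exists (g i a * star (g i a)) => f y; rewrite (rhoM rhoA) (rho_gen rhoA).
  by case: ifP => // /eqP <-; rewrite (rho_genS rhoA) ptailK.
exists (\sum_b g i b * q * star (g i b)) => f y.
have rsum (F : 'I_(n i).+1 -> A) : rho (\sum_b F b) f y = \sum_b rho (F b) f y.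
  apply: (big_morph (fun u => rho u f y)) => [u v|]; first exact: (rhoD rhoA).
  by rewrite -(ofbase0 (R := R)) (rho_base rhoA) mul0r.
rewrite rsum (bigD1 (y i 0%N)) //= big1 => [|b by0]; last first.
  by rewrite !(rhoM rhoA) (rho_gen rhoA) eq_sym (negPf by0).
rewrite addr0 !(rhoM rhoA) (rho_gen rhoA) eqxx qE ptail_in.
by case: ifP => // _; rewrite (rho_genS rhoA) ptailK.
Qed.

Lemma sends_emS w x y : sends (star (em w)) x y = (x == wact w y).
Proof.
rewrite /sends (kap_star mlA rhoA) /kap rho_em /delta conjc_nat.
by rewrite pnatr_eq0 eqb0 negbK.
Qed.

Lemma emS_pisom w : pisom (star (em w)).
Proof.
by rewrite /pisom /idem starK mulrA -[em w * _ * em w]mulrA (em_ortho mlA) mulr1.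
Qed.

Hypothesis kindS : kind S.

Lemma inP_cyl w x : inP (em w * star (em w)) x <-> exists y, x = wact w y.
Proof.
have := sends_dom mlA rhoA kindS x (emS_pisom w); rewrite starK => <-.
by split=> -[y yE]; exists y; move: yE; rewrite sends_emS => /eqP.
Qed.

Lemma proj_cyl w : proj (em w * star (em w)).
Proof. by have := pisom_proj (emS_pisom w); rewrite starK. Qed.

(** Two monomials with nonzero coefficients would send one translate of the aperiodic point to two
    different points. *)
Lemma pisom_normal v : pisom v -> exists N, forall w, deep N w ->
  exists r w', v * em w = ofbase r * em w'.
Proof.
move=> vP; have [N vN] := spanned_deep mlA v; exists N => w wd.
have [L [c [uL vE]]] := spanned_uniq (vN w wd).
have cE w' : w' \in L -> sends v (wact w z0) (wact w' z0) = (c w' != 0).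
  move=> wL; rewrite /sends /kap -rho_mul_em vE normal_coef //.
have [/hasP[w' w'L c0]|/hasPn c0] := boolP (has (fun w' => c w' != 0) L).
  exists (c w'), w'; rewrite vE (bigD1_seq w') //= big_seq_cond big1 ?addr0 //.
  move=> w2 /andP[w2L ww2]; suff -> : c w2 = 0 by rewrite ofbase0 mul0r.
  apply/eqP; apply: contraT => c20; move: ww2.
  rewrite -cE // in c0; rewrite -cE // in c20.
  have := sends_uniq mlA rhoA kindS vP c0 c20.
  by move=> /(wact_aperiodic_inj n_gt0) ->; rewrite eqxx.
exists 0, (@wnil I n); rewrite vE ofbase0 mul0r big_seq big1 // => w' /c0.
by rewrite negbK => /eqP ->; rewrite ofbase0 mul0r.
Qed.

(** On the cylinder of [wpre N x], the monomial form of [v * em (wpre N x)] exchanges that prefix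
    for [w], or annihilates the whole cylinder. *)
Lemma pisom_local v : pisom v -> exists N0, forall N x, (N0 <= N)%N ->
  (forall x', agree N x x' -> forall y, ~~ sends v x' y) \/
  exists w, forall x', agree N x x' -> sends v x' (wact w (pdrop N x')).
Proof.
move=> vP; have [N0 vN] := pisom_normal vP; exists N0 => N x NN.
have [r [w vE]] : exists r w, v * em (wpre N x) = ofbase r * em w.
  by apply: vN => i; rewrite size_mkseq.
have sE x' y : agree N x x' ->
    sends v x' y = (val r * delta (wact w (pdrop N x')) y != 0).
  move=> xx'; rewrite /sends /kap -{1}[x'](wpreK N) -(wpre_agree xx') -rho_mul_em.
  by rewrite vE rho_ofbase_em.
have [r0|r0] := eqVneq (val r) 0; [left|right; exists w] => x' xx'.
  by move=> y; rewrite sE // r0 mul0r eqxx.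
by rewrite sE // /delta eqxx mulr1.
Qed.

Lemma proj_depth p : proj p -> exists N, forall x x', agree N x x' ->
  inP p x = inP p x'.
Proof.
move=> pP; have [N pN] := pisom_local (proj_pisom pP); exists N => x x' xx'.
have sE x1 y : sends p x1 y = inP p x1 && (y == x1).
  rewrite /sends {1}/kap (proj_diag mlA rhoA kindS x1 pP) /delta.
  by case: (inP p x1); case: (y == x1);
     rewrite ?mul1r ?mul0r ?mulr0 ?eqxx ?oner_neq0.
have [p0|[w pw]] := pN N x (leqnn N).
  have := p0 x (fun _ _ _ => erefl) x; have := p0 x' xx' x'.
  by rewrite !sE !eqxx !andbT => /negPf -> /negPf ->.
have := pw x (fun _ _ _ => erefl); have := pw x' xx'.
by rewrite !sE => /andP[-> _] /andP[-> _].
Qed.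

Lemma sends_shift w w' x : sends (em w * star (em w')) (wact w' x) (wact w x).
Proof.
rewrite /sends /kap -rho_mul_em -mulrA (em_ortho mlA) mulr1 rho_em /delta.
by rewrite eqxx oner_neq0.
Qed.

Lemma pisom_shift w w' : pisom (em w * star (em w')).
Proof.
rewrite /pisom starM starK -mulrA [star (em w) * _]mulrA (em_ortho mlA) mul1r.
exact: (proj_cyl w').2.
Qed.

Lemma pisom_gen i a : pisom (g i a).
Proof. by rewrite /pisom (mlr_ortho (ml_rel mlA)) eqxx /idem mulr1. Qed.

Lemma sends_gen i a x y : sends (g i a) x y = (pcons a x == y).
Proof. by rewrite /sends (kap_gen rhoA) pnatr_eq0 eqb0 negbK. Qed.
End NormalForm.

(** * The map of points induced by an isomorphism *)

Lemma starring_iso_inv (A B : starRingType) (f : A -> B) (f' : B -> A) :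
  is_starring_iso f -> cancel f f' -> cancel f' f -> is_starring_iso f'.
Proof.
move=> [_ fD fM f1 fS] fK f'K; split.
- by exists f.
- by move=> x y; apply: (can_inj fK); rewrite fD !f'K.
- by move=> x y; apply: (can_inj fK); rewrite fM !f'K.
- by rewrite -f1 fK.
- by move=> x; apply: (can_inj fK); rewrite fS !f'K.
Qed.

Lemma starring_iso_proj (A B : starRingType) (f : A -> B) p :
  is_starring_iso f -> proj p -> proj (f p).
Proof. by move=> [_ _ fM _ fS] [ps pp]; split; rewrite /idem -?fS ?ps -?fM ?pp. Qed.

Lemma starring_iso_pisom (A B : starRingType) (f : A -> B) v :
  is_starring_iso f -> pisom v -> pisom (f v).
Proof. by move=> [_ _ fM _ fS] vv; rewrite /pisom /idem -fS -!fM vv. Qed.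

(** * Projections as clopen sets *)

Section ProjCalculus.
Variables (K : realType) (S : starSubring K) (I : finType) (n : I -> nat).
Local Notation R := (subring_type S).
Local Notation C := K[i].
Local Notation X := (pt n).
Variables (A : starAlgType R) (g : forall i, 'I_(n i).+1 -> A).
Arguments g : clear implicits.
Variables (mlA : multi_leavitt g) (rho : A -> (X -> C) -> X -> C).
Hypotheses (rhoA : point_rep g rho) (n_gt0 : forall i, (0 < n i)%N).
Hypothesis kindS : kind S.
Local Notation sends := (sends rho).
Local Notation inP := (inP rho).
Local Notation kap := (kap rho).

Lemma proj_mul p q : proj p -> proj q ->
  proj (p * q) /\ forall x, inP (p * q) x = inP p x && inP q x.
Proof.
move=> pP qP; apply: (diag_proj mlA rhoA n_gt0) => x.
rewrite (rhoM rhoA) (proj_diag mlA rhoA kindS x qP); apply/funext => y.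
rewrite (rhoZ rhoA) (proj_diag mlA rhoA kindS x pP) mulrA -natrM mulnb.
by rewrite andbC.
Qed.

Lemma proj_eq0 p : proj p -> (forall x, ~~ inP p x) -> p = 0.
Proof.
move=> pP p0; apply: (rho_faithful mlA rhoA n_gt0) => x; apply/funext => y.
by rewrite (proj_diag mlA rhoA kindS x pP) (negPf (p0 x)) mul0r.
Qed.

Lemma not_inP0 x : ~~ inP 0 x.
Proof. by rewrite /inP negbK /kap -(ofbase0 (R := R)) (rho_base rhoA) mul0r. Qed.

(** Preimages under the partial map of [a] are expressed by an algebraic formula, which isomorphisms
    preserve. *)
Lemma conj_proj a p : pisom a -> proj p -> proj (star a * p * a) /\
  forall x, inP (star a * p * a) x = `[< exists y, sends a x y /\ inP p y >].
Proof.
move=> aP pP; apply: (diag_proj mlA rhoA n_gt0) => x.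
have [a0|[y [c [c1 aE]]]] := pisom_delta mlA rhoA kindS x aP.
  have -> : `[< exists y, sends a x y /\ inP p y >] = false.
    by apply/asboolP => -[y []]; rewrite /sends a0 eqxx.
  rewrite !(rhoM rhoA); have -> : rho a (delta x) = fun=> 0.
    by apply/funext => y; exact: a0.
  have r0 u : rho u (fun=> 0) = fun=> 0 by apply/funext => z; exact: (rho0 rhoA).
  by rewrite !r0; apply/funext => y; rewrite mul0r.
have c0 : c != 0 by apply: contra_eq_neq c1 => ->; rewrite mul0r eq_sym oner_neq0.
have axy : sends a x y by rewrite /sends /kap aE /delta eqxx mulr1.
have -> : `[< exists y, sends a x y /\ inP p y >] = inP p y.
  apply/asboolP/idP => [[y' [axy' py']]|py]; last by exists y.
  by rewrite (sends_uniq mlA rhoA kindS aP axy axy').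
have adom : inP (star a * a) x by apply/(sends_dom mlA rhoA kindS x aP); exists y.
have := proj_diag mlA rhoA kindS x (pisom_proj aP).
rewrite adom (rhoM rhoA) aE => aaE.
rewrite !(rhoM rhoA) aE; apply/funext => z.
have -> : rho p (fun z => c * delta y z) =
    fun z => (inP p y)%:R * (c * delta y z).
  apply/funext => w; rewrite (rhoZ rhoA) (proj_diag mlA rhoA kindS y pP).
  by rewrite mulrCA.
by rewrite (rhoZ rhoA) aaE mul1r.
Qed.

Lemma inP_sep x y : (forall q, proj q -> inP q x -> inP q y) -> x = y.
Proof.
move=> xy; apply: pt_ext => i t.
have [q [qP qE]] := letter_proj mlA rhoA n_gt0 t (x i t).
by have := xy q qP; rewrite !qE eqxx => /(_ isT)/eqP.
Qed.

Lemma letter_sum i t (q : 'I_(n i).+1 -> A) :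
  (forall a, proj (q a)) -> (forall a x, inP (q a) x = (x i t == a)) ->
  \sum_a q a = 1.
Proof.
move=> qP qE; apply: (rho_inj mlA rhoA n_gt0) => x; apply/funext => y.
have rsum f : rho (\sum_b q b) f y = \sum_b rho (q b) f y.
  apply: (big_morph (fun u => rho u f y)) => [u v|]; first exact: (rhoD rhoA).
  by rewrite -(ofbase0 (R := R)) (rho_base rhoA) mul0r.
rewrite rsum -(ofbase1 (s := A)) (rho_base rhoA) (bigD1 (x i t)) //= big1.
  by rewrite (proj_diag mlA rhoA kindS x (qP _)) qE eqxx addr0.
move=> b bx; rewrite (proj_diag mlA rhoA kindS x (qP _)) qE eq_sym (negPf bx).
by rewrite mul0r.
Qed.
End ProjCalculus.

Section PointMap.
Variables (K : realType) (S : starSubring K) (I J : finType).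
Variables (n : I -> nat) (m : J -> nat).
Local Notation R := (subring_type S).
Local Notation C := K[i].
Local Notation X := (pt n).
Local Notation Y := (pt m).
Variables (A : starAlgType R) (gA : forall i, 'I_(n i).+1 -> A).
Variables (B : starAlgType R) (gB : forall j, 'I_(m j).+1 -> B).
Arguments gA : clear implicits.
Arguments gB : clear implicits.
Variables (mlA : multi_leavitt gA) (rhoA : A -> (X -> C) -> X -> C).
Variables (mlB : multi_leavitt gB) (rhoB : B -> (Y -> C) -> Y -> C).
Hypotheses (repA : point_rep gA rhoA) (repB : point_rep gB rhoB).
Hypotheses (n_gt0 : forall i, (0 < n i)%N) (m_gt0 : forall j, (0 < m j)%N).
Hypothesis kindS : kind S.

(** For each position the letter projections sum to 1, so the image of one of them contains [x];
    this spells out [y]. Any other projection depends on finitely many letters, so the letter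
    projections of [y] decide it. *)
Lemma point_image (psi : B -> A) (x : X) : is_starring_iso psi ->
  exists y : Y, forall q, proj q -> inP rhoB q y = inP rhoA (psi q) x.
Proof.
move=> psiI; have psiP p (pP : proj p) : proj (psi p) := starring_iso_proj psiI pP.
case: (psiI) => _ psiD psiM psi1 psiS.
have psi0 : psi 0 = 0 by apply: (addrI (psi 0)); rewrite -psiD !addr0.
have q j t (a : 'I_(m j).+1) := cid (letter_proj mlB repB m_gt0 t a).
have qx j t : exists a, inP rhoA (psi (projT1 (q j t a))) x.
  have qP a : proj (projT1 (q j t a)) by case: (q j t a) => /= ? [].
  have qE a y : inP rhoB (projT1 (q j t a)) y = (y j t == a).
    by case: (q j t a) => /= ? [].
  have := congr1 psi (letter_sum mlB repB m_gt0 kindS qP qE).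
  rewrite psi1 (big_morph psi psiD psi0) => s1.
  apply: contrapT => /forallNP nq.
  have : kap rhoA 1 x x = 0.
    rewrite -s1; elim/big_ind: _ => [|u v u0 v0|a _].
    - by apply/eqP; have := not_inP0 repA x; rewrite /inP negbK.
    - by rewrite (kapD repA) u0 v0 addr0.
    - by apply/eqP; rewrite -[_ == _]negbK; apply/negP; exact: nq.
  rewrite /kap -(ofbase1 (s := A)) (rho_base repA) mul1r /delta eqxx => /eqP.
  by rewrite oner_eq0.
pose y : Y := fun j t => projT1 (cid (qx j t)).
have yE j t : inP rhoA (psi (projT1 (q j t (y j t)))) x.
  by rewrite /y; case: (cid _).
exists y => p pP; have [N pN] := proj_depth mlB repB m_gt0 kindS pP.
have sub p' : proj p' ->
    (forall y', agree N y y' -> inP rhoB p' y = inP rhoB p' y') ->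
    inP rhoA (psi p') x -> inP rhoB p' y.
  move=> pP' pN' p'x; apply: contraT => p'y.
  have cyl (s : seq (J * nat)) : exists c, [/\ proj c, inP rhoA (psi c) x &
      forall y', inP rhoB c y' -> all (fun u => y' u.1 u.2 == y u.1 u.2) s].
    elim: s => [|[j t] s [c [cP cx cE]]].
      have one_proj : proj (1 : B) by split; rewrite ?star1 // /idem mulr1.
      exists 1; split=> //; rewrite psi1 /inP /kap -(ofbase1 (s := A)).
      by rewrite (rho_base repA) mul1r /delta eqxx oner_neq0.
    have /= := yE j t; case: (q j t (y j t)) => /= r [rP rE] rx.
    have [rcP rcE] := proj_mul mlB repB m_gt0 kindS rP cP.
    exists (r * c); split=> // [|y']; last by rewrite rcE rE => /andP[-> /cE].
    have [_ rcx] := proj_mul mlA repA n_gt0 kindS (psiP _ rP) (psiP _ cP).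
    by rewrite psiM rcx rx cx.
  have [c [cP cx cE]] := cyl [seq (j, t) | j <- enum J, t <- iota 0 N].
  have [cpP cpE] := proj_mul mlB repB m_gt0 kindS cP pP'.
  (* If [p'] misses [y], it misses the cylinder [c] around [y], yet the images of both contain
     [x]. *)
  have cp0 : c * p' = 0.
    apply: (proj_eq0 mlB repB m_gt0 kindS) => // y'; rewrite cpE.
    apply/negP => /andP[/cE /allP cy' py']; move: p'y; rewrite (pN' y') ?py' //.
    move=> j t tN; apply/esym/eqP/(cy' (j, t)).
    by rewrite (allpairs_f pair) ?mem_enum ?mem_iota.
  have := not_inP0 repA x; rewrite -psi0 -cp0 psiM.
  have [_ ->] := proj_mul mlA repA n_gt0 kindS (psiP _ cP) (psiP _ pP').
  by rewrite cx p'x.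
apply/idP/idP => [|px]; last by apply: sub => // y'; exact: pN.
(* The converse implication is [sub] for the complementary projection. *)
apply: contraLR => px; rewrite -(inP1B mlB repB kindS) //.
apply: sub; first exact: proj1B.
  by move=> y' yy'; rewrite !(inP1B mlB repB kindS) // (pN y y').
have -> : psi (1 - p) = 1 - psi p.
  by apply: (addIr (psi p)); rewrite -psiD !subrK.
by rewrite (inP1B mlA repA kindS) //; exact: psiP.
Qed.

Variables (phi : A -> B) (psi : B -> A) (h : X -> Y).
Hypotheses (phiI : is_starring_iso phi) (phiK : cancel phi psi).
Hypothesis psiK : cancel psi phi.
Hypothesis hP : forall x q, proj q -> inP rhoB q (h x) = inP rhoA (psi q) x.

Lemma inP_image x p : proj p -> inP rhoB (phi p) (h x) = inP rhoA p x.
Proof. by move=> pP; rewrite hP ?phiK //; exact: starring_iso_proj. Qed.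

(** Domain projections correspond, so [phi a] sends [h x] somewhere. Preimages of projections
    correspond too, so every projection containing that point contains [h y], and projections
    separate points. *)
Lemma sends_image a x y : pisom a -> sends rhoA a x y ->
  sends rhoB (phi a) (h x) (h y).
Proof.
move=> aP axy; have vP := starring_iso_pisom phiI aP.
have psiI := starring_iso_inv phiI phiK psiK.
case: (phiI) => _ phiD phiM phi1 phiS.
have [z vz] : exists z, sends rhoB (phi a) (h x) z.
  apply/(sends_dom mlB repB kindS (h x) vP); rewrite -phiS -phiM inP_image.
    by apply/(sends_dom mlA repA kindS x aP); exists y.
  exact: pisom_proj.
suff <- : z = h y by [].
apply: (inP_sep mlB repB m_gt0) => q qP qz; rewrite hP //.
have pP := starring_iso_proj psiI qP.
have [apP apE] := conj_proj mlA repA n_gt0 kindS aP pP.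
have [_ vqE] := conj_proj mlB repB m_gt0 kindS vP qP.
have : inP rhoB (star (phi a) * q * phi a) (h x).
  by rewrite vqE; apply/asboolP; exists z.
rewrite -[q]psiK -phiS -!phiM inP_image // apE => /asboolP[y' [axy']].
by rewrite phiK (sends_uniq mlA repA kindS aP axy axy').
Qed.

(** The preimage of a cylinder under [h] is given by a projection of [A], hence depends on finitely
    many letters. *)
Lemma point_map_continuous x N :
  exists M, forall x', agree M x x' -> agree N (h x) (h x').
Proof.
have psiI := starring_iso_inv phiI phiK psiK.
have cP := proj_cyl mlB (wpre N (h x)).
have [M MP] := proj_depth mlA repA n_gt0 kindS (starring_iso_proj psiI cP).
exists M => x' xx'; apply/agreeP/(inP_cyl mlB repB kindS).
rewrite hP // -(MP x x') // -hP //; apply/(inP_cyl mlB repB kindS)/agreeP.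
by move=> j t _.
Qed.
End PointMap.

(** * Counting words modulo q *)

Local Close Scope ring_scope.

Section Sequences.
Variable T : Type.
Definition sagree N (c d : nat -> T) := forall t, t < N -> c t = d t.
Definition scat (w : seq T) (c : nat -> T) : nat -> T :=
  fun t => nth (c (t - size w)) w t.

Lemma scat_nil c : scat [::] c = c.
Proof. by apply/funext => t; rewrite /scat nth_default // subn0. Qed.

Lemma scat_cons a w c : scat (a :: w) c = scons a (scat w c).
Proof. by apply/funext => -[|t]. Qed.

Lemma scat_rcons a w c : scat (rcons w a) c = scat w (scons a c).
Proof.
elim: w => [|b w IH]; first by rewrite /= scat_cons !scat_nil.
by rewrite rcons_cons !scat_cons IH.
Qed.

Lemma scons_inj a b (c d : nat -> T) : scons a c = scons b d -> a = b /\ c = d.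
Proof.
move=> E; split; first exact: (congr1 (fun f => f 0) E).
by apply/funext => t; exact: (congr1 (fun f => f t.+1) E).
Qed.

Lemma scat_inj w : injective (scat w).
Proof.
elim: w => [|a w IH] c d; first by rewrite !scat_nil.
by rewrite !scat_cons => /scons_inj[_ /IH].
Qed.

Lemma scat_cat (s w : seq T) c : scat (s ++ w) c = scat s (scat w c).
Proof. by elim: s => [|a s IH]; rewrite ?scat_nil // cat_cons !scat_cons IH. Qed.

Lemma sconsK (c : nat -> T) : scons (c 0) (fun t => c t.+1) = c.
Proof. by apply/funext => -[]. Qed.

Lemma sagree_cons N a c d : sagree N c d -> sagree N.+1 (scons a c) (scons a d).
Proof. by move=> cd [|t] //=; exact: cd. Qed.

Lemma sagreeP N (c e : nat -> T) :
  sagree N c e <-> exists d, e = scat (mkseq c N) d.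
Proof.
split=> [ce|[d ->] t tN].
  exists (fun t => e (t + N)); apply/funext => t; rewrite /scat size_mkseq.
  have [tN|Nt] := ltnP t N; first by rewrite nth_mkseq // ce.
  by rewrite nth_default ?size_mkseq // subnK.
by rewrite /scat (set_nth_default (c 0)) ?size_mkseq // nth_mkseq.
Qed.

Definition depth N (D : (nat -> T) -> Prop) :=
  forall c d, sagree N c d -> D c -> D d.

Lemma depth_scons N D a : depth N.+1 D -> depth N (fun c => D (scons a c)).
Proof. by move=> DN c d cd; apply: DN; exact: sagree_cons. Qed.

Lemma depth_le N N' D : N <= N' -> depth N D -> depth N' D.
Proof.
by move=> NN DN c d cd; apply: DN => t tN; apply: cd; exact: leq_trans NN.
Qed.
End Sequences.
Arguments scons_inj {T a b c d}.

(* The class in [Z/q] of a clopen set of sequences over [q+1] letters is its  *)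
(* number of words of length [N], which does not depend on [N] large.         *)
Section Class.
Variable q : nat.
Local Notation Q := (nat -> 'I_q.+1).

(** Words are completed by zeros; the completion is immaterial once [D] has depth [N]. *)
Fixpoint wcount N (D : Q -> Prop) : nat :=
  if N is N'.+1 then \sum_a wcount N' (fun c => D (scons a c))
  else `[< D (fun=> ord0) >].

Definition has_class D r :=
  exists N0, forall N, N0 <= N -> wcount N D = r %[mod q].

Lemma has_class_uniq D r r' :
  has_class D r -> has_class D r' -> r = r' %[mod q].
Proof.
move=> [N rN] [N' rN']; rewrite -(rN (N + N')) ?leq_addr //.
by rewrite rN' // leq_addl.
Qed.

Lemma has_class_mod D r r' : r = r' %[mod q] -> has_class D r -> has_class D r'.
Proof. by move=> rr [N rN]; exists N => N' NN; rewrite rN. Qed.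

Lemma has_class_iff D D' r :
  (forall c, D c <-> D' c) -> has_class D r -> has_class D' r.
Proof.
move=> DD; have -> // : D = D'.
by apply/funext => c; apply/propext.
Qed.

Lemma modn_sum (W : finType) (E F : W -> nat) :
  (forall w, E w = F w %[mod q]) -> \sum_w E w = \sum_w F w %[mod q].
Proof.
move=> EF; elim/big_rec2: _ => // w a b _ ab.
by rewrite -modnDm EF ab modnDm.
Qed.

Lemma has_class_scons D r :
  (forall a, has_class (fun c => D (scons a c)) (r a)) ->
  has_class D (\sum_a r a).
Proof.
move=> /choice[N rN]; exists (\max_a N a).+1 => -[//|M] /= NM.
by apply: modn_sum => a; apply: rN; exact: leq_trans (leq_bigmax a) NM.
Qed.

Lemma wcount_union (W : finType) (E : W -> Q -> Prop) N D :
  (forall c, D c <-> exists w, E w c) ->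
  (forall w w' c, E w c -> E w' c -> w = w') ->
  wcount N D = \sum_w wcount N (E w).
Proof.
elim: N E D => [|N IH] E D DE Einj /=.
  case: asboolP => [/DE[w Ew]|nD].
    rewrite (bigD1 w) //= big1 ?addn0; first by rewrite asboolT.
    move=> w' ww'; rewrite asboolF // => Ew'.
    by rewrite (Einj _ _ _ Ew Ew') eqxx in ww'.
  rewrite big1 // => w _; rewrite asboolF // => Ew.
  by apply: nD; apply/DE; exists w.
rewrite exchange_big; apply: eq_bigr => a _; apply: IH => [c|w w' c].
  exact: DE.
exact: Einj.
Qed.

Lemma has_class_union (W : finType) (E : W -> Q -> Prop) (r : W -> nat) D :
  (forall c, D c <-> exists w, E w c) ->
  (forall w w' c, E w c -> E w' c -> w = w') ->
  (forall w, has_class (E w) (r w)) -> has_class D (\sum_w r w).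
Proof.
move=> DE Einj /choice[N rN]; exists (\max_w N w) => M NM.
rewrite (wcount_union M DE Einj); apply: modn_sum => w; apply: rN.
by apply: leq_trans NM; exact: leq_bigmax.
Qed.

Lemma has_class_const (P : Prop) : has_class (fun=> P) (`[< P >] : bool).
Proof.
exists 0 => N _; elim: N => [//|N IH] /=.
(* Each word has q+1 one-letter extensions, and q+1 is 1 modulo q. *)
by rewrite sum_nat_const card_ord -modnMmr IH modnMmr mulSn addnC [q * _]mulnC modnMDl.
Qed.

Lemma has_class_depth N D : depth N D -> has_class D (wcount N D).
Proof.
elim: N D => [|N IH] D DN; last first.
  by apply: has_class_scons => a; apply: IH; exact: depth_scons.
apply: has_class_iff (has_class_const (D (fun=> ord0))) => c.
by split; exact: DN.
Qed.

Lemma has_class_cyl w : has_class (fun c : Q => exists d, c = scat w d) 1.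
Proof.
elim: w => [|b w IH].
  apply: (@has_class_iff (fun=> True)) (_ : has_class _ 1) => [c|].
    by split=> // _; exists c; rewrite scat_nil.
  by have := has_class_const True; rewrite asboolT.
have -> : 1 = \sum_(a : 'I_q.+1) (a == b).
  by rewrite (bigD1 b) //= eqxx big1 // => a /negPf ->.
apply: has_class_scons => a; have [->|ab] := eqVneq a b.
  apply: has_class_iff IH => c; split=> -[d].
    by move=> ->; exists d; rewrite scat_cons.
  by rewrite scat_cons => E; have [_ cE] := scons_inj E; exists d.
have := has_class_const False; rewrite asboolF //; apply: has_class_iff => c.
by split=> // -[d]; rewrite scat_cons => /scons_inj[abE]; rewrite abE eqxx in ab.
Qed.

(** An injective map that replaces prefixes of length [N] carries each such cylinder of [D] onto a
    cylinder. All cylinders have class 1 and the images are disjoint, so the class is preserved. *)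
Lemma has_class_transport N (D D' : Q -> Prop) (E : Q -> Q -> Prop) :
  depth N D ->
  (forall c, D c -> exists w, forall d, sagree N c d ->
     forall e, E d e <-> e = scat w (fun t => d (t + N))) ->
  (forall c d e, E c e -> E d e -> c = d) ->
  (forall e, D' e <-> exists2 c, D c & E c e) ->
  has_class D' (wcount N D).
Proof.
elim: N D D' E => [|N IH] D D' E DN Eloc Einj D'E.
  have s0 (c d : Q) : sagree 0 c d by [].
  rewrite /=; case: asboolP => [D0|nD].
    have [w wE] := Eloc _ D0; apply: has_class_iff (has_class_cyl w) => e.
    rewrite D'E; split=> [[d ->]|[c _ /(wE c (s0 _ _)) ->]]; last by eexists.
    exists d; first exact: DN D0.
    by apply/wE => //; congr scat; apply/funext => t; rewrite addn0.
  have := has_class_const False; rewrite asboolF //; apply: has_class_iff => e.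
  by split=> // /D'E[c Dc _]; apply: nD; exact: DN (s0 _ _) Dc.
apply: (@has_class_union _ (fun a e => exists2 c, D (scons a c) & E (scons a c) e)).
- move=> e; rewrite D'E; split=> [[c Dc Ec]|[a [c Dc Ec]]]; last by eexists; eauto.
  by exists (c 0); exists (fun t => c t.+1); rewrite sconsK.
- by move=> a b e [c _ Ec] [d _ /(Einj _ _ _ Ec)/scons_inj[]].
move=> a; apply: (IH _ _ (fun c => E (scons a c))); first exact: depth_scons.
- move=> c /Eloc[w wE]; exists w => d cd e.
  rewrite (wE _ (sagree_cons _ cd)).
  suff -> : (fun t => scons a d (t + N.+1)) = (fun t => d (t + N)) by [].
  by apply/funext => t; rewrite addnS.
- by move=> c d e Ec /(Einj _ _ _ Ec)/scons_inj[].
- by [].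
Qed.
End Class.

(** * Divisibility from an embedded shift *)

Section EmbeddedShift.
Variables (p q : nat).
Local Notation P := (nat -> 'I_p.+1).
Local Notation Q := (nat -> 'I_q.+1).
Variable kappa : P -> Q.
Hypothesis kappa_inj : injective kappa.
Definition kimage w (c : Q) := exists u, c = kappa (scat w u).
Hypothesis kimage_depth : forall w, exists N, depth N (kimage w).
Hypothesis kappa_continuous : forall N c, exists M,
  depth M (fun u => sagree N c (kappa u)).
Hypothesis kappa_scons : forall a, exists N0, forall N u, N0 <= N -> exists w,
  forall u', sagree N (kappa u) (kappa u') ->
  kappa (scons a u') = scat w (fun t => kappa u' (t + N)).

(** Prepending [a] in the source is, after [kappa], an injective local prefix replacement, so
    [has_class_transport] applies. *)
Lemma kimage_cons_class w a r :
  has_class (kimage w) r -> has_class (kimage (a :: w)) r.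
Proof.
move=> wr; have [N0 wN0] := kimage_depth w; have [N1 aN1] := kappa_scons a.
pose N := maxn N0 N1.
have wN : depth N (kimage w) by apply: depth_le wN0; exact: leq_maxl.
apply: has_class_mod (has_class_uniq (has_class_depth wN) wr) _.
apply: (has_class_transport (E := fun c e =>
  exists2 u, c = kappa u & e = kappa (scons a u))) => //.
- move=> c [u ->]; have [v vE] := aN1 N (scat w u) (leq_maxr _ _).
  exists v => d cd e; split=> [[u' du' ->]|->].
    by rewrite du' -vE // -du'.
  have [u' du'] : kimage w d by apply: wN cd _; exists u.
  by exists (scat w u') => //; rewrite vE -?du'.
- by move=> c d e [u -> ->] [u' ->] /kappa_inj/scons_inj[_ uu]; rewrite uu.
move=> e; split=> [[u ->]|[c [u ->] [u' /kappa_inj <- ->]]].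
  by exists (kappa (scat w u)); [exists u|exists (scat w u); rewrite // scat_cons].
by exists u; rewrite scat_cons.
Qed.

Lemma kimage_class r w : has_class (kimage [::]) r -> has_class (kimage w) r.
Proof. by move=> r0; elim: w => // a w; exact: kimage_cons_class. Qed.

(** A clopen set is a finite disjoint union of cylinders, whose images all have class [r]. *)
Lemma kimage_clopen_class r : has_class (kimage [::]) r ->
  forall M w (E : P -> Prop), depth M E -> exists s,
  has_class (fun c => exists2 u, E u & c = kappa (scat w u)) (s * r).
Proof.
move=> r0; elim=> [|M IH] w E EM.
  have [[u0 E0]|nE] := pselect (exists u, E u).
    exists 1; rewrite mul1n; apply: has_class_iff (kimage_class w r0) => c.
    split=> [[u ->]|[u _ ->]]; last by exists u.
    by exists u => //; exact: EM E0.
  exists 0; have := has_class_const q False; rewrite asboolF //.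
  by apply: has_class_iff => c; split=> // -[u Eu _]; apply: nE; exists u.
have /choice[s sP] a := IH (rcons w a) _ (depth_scons (a := a) EM).
exists (\sum_a s a); rewrite big_distrl.
apply: has_class_union sP => [c|a b c [u _ ->] [v _ /kappa_inj]].
  split=> [[u Eu ->]|[a [u Eu ->]]].
    exists (u 0); exists (fun t => u t.+1); rewrite ?scat_rcons sconsK //.
  by exists (scons a u); rewrite // scat_rcons.
by rewrite !scat_rcons => /scat_inj/scons_inj[].
Qed.

Lemma embedded_shift_dvd : q %| p.
Proof.
have [N KN] := kimage_depth [::].
pose r := wcount N (kimage [::]).
have r0 : has_class (kimage [::]) r := has_class_depth KN.
(* The image splits by first letter into p+1 pieces, each of class [r]. *)
have rp : p.+1 * r = r %[mod q].
  rewrite -(card_ord p.+1) -sum_nat_const; apply: (has_class_uniq _ r0).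
  apply: (has_class_union (E := fun a => kimage [:: a])).
  - move=> c; split=> [[u]|[a [u ->]]].
      rewrite scat_nil => ->; exists (u 0); exists (fun t => u t.+1).
      by rewrite scat_cons scat_nil sconsK.
    by exists (scat [:: a] u); rewrite scat_nil.
  - move=> a b c [u ->] [v /kappa_inj].
    by rewrite !scat_cons => /scons_inj[].
  - by move=> a; exact: (kimage_class _ r0).
(* To invert [r]: a small cylinder around a point of the image lies inside the image. It has class
   1, and it is the image of a clopen set, so its class is also a multiple of [r]. *)
pose c0 := kappa (fun=> ord0).
have [M EM] := kappa_continuous N c0.
have [s sP] := kimage_clopen_class r0 [::] EM.
have s1 : s * r = 1 %[mod q].
  apply: (has_class_uniq sP).
  apply: has_class_iff (has_class_cyl (mkseq c0 N)) => c.
  rewrite -sagreeP; split=> [cd|[u cu ->]]; last by rewrite scat_nil.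
  have [u uE] : kimage [::] c.
    by apply: KN cd _; exists (fun=> ord0); rewrite scat_nil.
  by exists u => //; rewrite scat_nil in uE; rewrite -uE.
have pr : q %| p * r.
  have /eqP := rp; rewrite eqn_mod_dvd ?mulSn ?leq_addr //.
  by rewrite addKn.
rewrite /dvdn -[p]muln1 -modnMmr -s1 modnMmr mulnCA.
by rewrite -/(dvdn _ _) dvdn_mull.
Qed.
End EmbeddedShift.

(** * Local structure of the point map *)

(* A sequence fixed by exchanging prefixes of different lengths is determined *)
(* by its initial segment: it is eventually periodic.                         *)
Lemma prefix_swap_uniq (T : Type) (w : seq T) N (c e : nat -> T) :
  size w != N -> c = scat w (fun t => c (t + N)) ->
  e = scat w (fun t => e (t + N)) -> sagree N c e -> c = e.
Proof.
move=> wN cE eE ce; set k := size w in wN.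
have lt_w t : t < k -> c t = e t.
  by move=> tk; rewrite cE eE /scat (set_nth_default (e (t - size w + N))).
have ge_w (f : nat -> T) t : f = scat w (fun t => f (t + N)) -> f (k + t) = f (N + t).
  by move=> fE; rewrite {1}fE /scat nth_default ?leq_addr // addKn addnC.
apply/funext => t; elim/ltn_ind: t => t IH.
have [tk|kt] := ltnP t k; first exact: lt_w.
have [tN|Nt] := ltnP t N; first exact: ce.
case: (ltngtP k N) wN => // kN _.
  have -> : t = N + (t - N) by lia.
  by rewrite -!ge_w //; apply: IH; lia.
have -> : t = k + (t - k) by lia.
by rewrite !ge_w //; apply: IH; lia.
Qed.

Section PointUpdates.
Variables (I : finType) (n : I -> nat).

Lemma wact_scat (w : word n) (x : pt n) i : wact w x i = scat (w i) (x i).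
Proof. by []. Qed.

Lemma wact_dfwith (w : word n) (x : pt n) i (s : seq 'I_(n i).+1)
    (u : nat -> 'I_(n i).+1) :
  wact (dfwith w s) (dfwith x u) = dfwith (wact w x) (scat s u).
Proof.
apply: functional_extensionality_dep => j; rewrite wact_scat.
have [ij|ij] := eqVneq i j; last by rewrite !dfwith_out.
by case: j / ij; rewrite !dfwith_in.
Qed.

Lemma dfwith_sagree (x : pt n) i N (c d : nat -> 'I_(n i).+1) :
  sagree N c d -> agree N (dfwith x c) (dfwith x d).
Proof.
move=> cd j t tN; have [ij|ij] := eqVneq i j; last by rewrite !dfwith_out.
by case: j / ij; rewrite !dfwith_in cd.
Qed.

(** Where the prefix lengths agree, the exchange leaves any point near [x] unchanged; where they
    differ, fixed sequences are rigid by [prefix_swap_uniq]. *)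
Lemma prefix_swap_fixed (w : word n) N (x y : pt n) :
  x = wact w (pdrop N x) -> agree N x y ->
  y = wact w (pdrop N y) <-> forall i, size (w i) != N -> y i = x i.
Proof.
move=> xE xy; split=> [yE i wN|yx].
  apply/esym/(prefix_swap_uniq wN).
  - exact: (congr1 (fun z : pt n => z i) xE).
  - exact: (congr1 (fun z : pt n => z i) yE).
  - exact: xy.
apply: functional_extensionality_dep => i.
have [wN|wN] := eqVneq (size (w i)) N.
  apply/funext => t; have [tN|Nt] := ltnP t N.
    rewrite -xy // {1}xE /wact.
    by rewrite (set_nth_default (pdrop N y i (t - size (w i)))) ?wN.
  by rewrite /wact nth_default ?wN // /pdrop subnK.
have xEi := congr1 (fun z : pt n => z i) xE.
rewrite wact_scat /pdrop yx //; exact: xEi.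
Qed.
End PointUpdates.

Section LocalStructure.
Variables (K : realType) (S : starSubring K) (I J : finType).
Variables (n : I -> nat) (m : J -> nat).
Local Notation R := (subring_type S).
Local Notation C := K[i].
Local Notation X := (pt n).
Local Notation Y := (pt m).
Variables (A : starAlgType R) (gA : forall i, 'I_(n i).+1 -> A).
Variables (B : starAlgType R) (gB : forall j, 'I_(m j).+1 -> B).
Arguments gA : clear implicits.
Arguments gB : clear implicits.
Variables (mlA : multi_leavitt gA) (rhoA : A -> (X -> C) -> X -> C).
Variables (mlB : multi_leavitt gB) (rhoB : B -> (Y -> C) -> Y -> C).
Hypotheses (repA : point_rep gA rhoA) (repB : point_rep gB rhoB).
Hypotheses (n_gt0 : forall i, (0 < n i)%N) (m_gt0 : forall j, (0 < m j)%N).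
Hypothesis kindS : kind S.
Variables (phi : A -> B) (psi : B -> A) (h : X -> Y) (h' : Y -> X).
Hypotheses (phiI : is_starring_iso phi) (phiK : cancel phi psi).
Hypothesis psiK : cancel psi phi.
Hypothesis hP : forall x q, proj q -> inP rhoB q (h x) = inP rhoA (psi q) x.
Hypotheses (hK : cancel h h') (h'K : cancel h' h).

Let sendsE := sends_image mlA mlB repA repB n_gt0 m_gt0 kindS phiI phiK psiK hP.
Let h_inj : injective h := can_inj hK.

Definition zero_pt : X := fun _ _ => ord0.
Local Notation x0 := zero_pt.
Local Notation v i := (phi (gA i ord0)).

Let h_continuous :=
  point_map_continuous mlA mlB repA repB n_gt0 kindS phiI phiK psiK hP x0.

Lemma gen_pisom i : pisom (v i).
Proof. by apply: (starring_iso_pisom phiI); exact: pisom_gen. Qed.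

Lemma sends_gen_image i x : sends rhoB (v i) (h x) (h (pcons (i := i) ord0 x)).
Proof. by apply: sendsE; [exact: pisom_gen|rewrite (sends_gen repA)]. Qed.

(** Being a fixed point is transported by [h], and a word equal to itself with 0 prepended is
    constant 0. *)
Lemma gen_fixed i x :
  sends rhoB (v i) (h x) (h x) <-> x i = fun=> ord0.
Proof.
split=> [vx|xi0].
  have /h_inj xE :=
    sends_uniq mlB repB kindS (gen_pisom i) vx (sends_gen_image i x).
  have {}xE : x i = scons ord0 (x i) by rewrite {1}xE pcons_in.
  by apply/funext; elim=> [|t IH]; rewrite xE.
suff {2}<- : pcons (ord0 : 'I_(n i).+1) x = x by exact: sends_gen_image.
apply: functional_extensionality_dep => j.
have [ij|ij] := eqVneq i j; last by rewrite pcons_out.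
by case: j / ij; rewrite pcons_in xi0; apply/funext => -[].
Qed.

(* [s i] is the set of coordinates of [h x0] shifted by the image of the      *)
(* [i]-th generator.                                                          *)
Lemma shifted_coords : exists N (s : I -> {set J}), forall x i,
  agree N (h x0) (h x) ->
  x i = (fun=> ord0) <-> forall j, j \in s i -> h x j = h x0 j.
Proof.
have [N0 vN] := choice (fun i => pisom_local mlB repB m_gt0 kindS (gen_pisom i)).
pose N := \max_i N0 i; exists N.
have vy i : sends rhoB (v i) (h x0) (h x0) by apply/gen_fixed.
have /choice[w wE] i : exists w : word m, forall y', agree N (h x0) y' ->
    sends rhoB (v i) y' (wact w (pdrop N y')).
  have [none|//] := vN i N (h x0) (leq_bigmax i).
  by have := none (h x0) (fun _ _ _ => erefl) (h x0); rewrite vy.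
exists (fun i => [set j | size (w i j) != N]) => x i xN.
have fixE y' : agree N (h x0) y' ->
    sends rhoB (v i) y' y' <-> y' = wact (w i) (pdrop N y').
  move=> yN; split=> [vy'|yE]; last by rewrite {2}yE; exact: wE.
  exact: (sends_uniq mlB repB kindS (gen_pisom i) vy' (wE i _ yN)).
have x0E : h x0 = wact (w i) (pdrop N (h x0)) by apply/fixE.
rewrite -gen_fixed fixE // (prefix_swap_fixed x0E xN).
by split=> H j; have := H j; rewrite inE.
Qed.

(** If [s i] were covered by the other sets, then near [x0] vanishing of all other coordinates would
    force coordinate [i] to vanish. *)
Lemma axes_matching : exists N (s : I -> {set J}) (sigma : I -> J), [/\
  forall x i, agree N (h x0) (h x) ->
    x i = (fun=> ord0) <-> forall j, j \in s i -> h x j = h x0 j,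
  forall i, sigma i \in s i & forall i i', i' != i -> sigma i \notin s i'].
Proof.
have [N [s sE]] := shifted_coords; exists N, s.
have [M MN] := h_continuous N.
suff /choice[sigma sP] i :
    exists j, j \in s i /\ forall i', i' != i -> j \notin s i'.
  by exists sigma; split=> // [i|i i' /(proj2 (sP i))//]; case: (sP i).
apply: contrapT => /forallNP none.
(* A counterexample close to [x0]: a single letter 1 in coordinate [i], placed just beyond the [M]
   letters that continuity controls. *)
pose x : X := dfwith x0 (fun t => if t == M then inord 1 else ord0 : 'I_(n i).+1).
have xM : agree N (h x0) (h x).
  apply: MN => j t tM; have [ij|ij] := eqVneq i j; last by rewrite /x dfwith_out.
  by case: j / ij; rewrite /x dfwith_in ltn_eqF.
have /(congr1 (fun f => val (f M))) : x i = fun=> ord0.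
  apply/(sE x i xM) => j js; apply: contrapT => hj.
  apply: (none j); split=> // i' ii'.
  apply/negP => js'; apply: hj; apply: (proj1 (sE x i' xM) _ j js').
  by rewrite /x dfwith_out // eq_sym.
by rewrite /x dfwith_in eqxx /= inordK // ltnS n_gt0.
Qed.

Lemma coords_leq : #|I| <= #|J|.
Proof.
have [N [s [sigma [_ sP sN]]]] := axes_matching.
apply: (@leq_card _ _ sigma) => i i' ii'; apply/eqP; apply: contraT => ne.
by have := sN i' i ne; rewrite -ii' sP.
Qed.

Section Slice.
Variables (N : nat) (i : I) (k : J).
Hypothesis slice : forall x, agree N (h x0) (h x) ->
  (forall i', i' != i -> x i' = fun=> ord0) <-> forall j, j != k -> h x j = h x0 j.

(** The slice in direction [i] is a shift on [(n i).+1] letters, and [h] embeds it in a shift on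
    [(m k).+1] letters, as [embedded_shift_dvd] requires. *)
Lemma slice_dvd : m k %| n i.
Proof.
have [M MN] := h_continuous N.
(* The [M] leading zeros keep the points in the neighbourhood of [x0] where [slice] applies. *)
pose z : seq 'I_(n i).+1 := nseq M ord0.
have zE u t : t < M -> scat z u t = ord0.
  by move=> tM; rewrite /scat (set_nth_default ord0) ?size_nseq // nth_nseq tM.
pose iota_ u : X := dfwith x0 (scat z u).
have iotaM u : agree M x0 (iota_ u).
  move=> j t tM; have [ij|ij] := eqVneq i j; last by rewrite /iota_ dfwith_out.
  by case: j / ij; rewrite /iota_ dfwith_in zE.
pose kappa u := h (iota_ u) k.
have hiota u : h (iota_ u) = dfwith (h x0) (kappa u).
  have /slice[sl _] := MN _ (iotaM u).
  apply: functional_extensionality_dep => j; have [kj|kj] := eqVneq k j.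
    by case: j / kj; rewrite dfwith_in.
  rewrite dfwith_out // sl // 1?eq_sym // => i' ii'.
  by rewrite /iota_ dfwith_out // eq_sym.
have iota_inj : injective iota_.
  move=> u u' /(congr1 (fun x : X => x i)); rewrite /iota_ !dfwith_in.
  exact: scat_inj.
have psiI := starring_iso_inv phiI phiK psiK.
have imP := inP_image phiI phiK hP.
have kpsi := proj_depth mlB repB m_gt0 kindS.
apply: (@embedded_shift_dvd _ _ kappa).
- move=> u u' uu; apply/iota_inj/h_inj; rewrite !hiota uu //.
(* The prefix is imposed in every coordinate so that any point of this cylinder is near [x0];
   [slice] then puts it on the slice. *)
- move=> w; pose ga := dfwith (wpre M x0) (z ++ w) : word n.
  have pP := proj_cyl mlA ga.
  set p := (em gA ga * _)%R in pP.
  have [N' N'P] := kpsi _ (starring_iso_proj phiI pP).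
  suff kE c : kimage kappa w c <-> inP rhoB (phi p) (dfwith (h x0) c).
    exists N' => c d cd; rewrite !kE (N'P _ (dfwith (h x0) d)) //.
    exact: dfwith_sagree.
  have gaE u : wact ga (dfwith x0 u) = iota_ (scat w u).
    by rewrite wact_dfwith scat_cat (wpreK M x0 : wact (wpre M x0) x0 = x0).
  split=> [[u ->]|].
    rewrite -hiota imP //; apply/(inP_cyl mlA repA kindS).
    by exists (dfwith x0 u); rewrite gaE.
  rewrite -[dfwith _ c]h'K imP //; set x := h' _.
  have hx : h x = dfwith (h x0) c by rewrite h'K.
  move=> /(inP_cyl mlA repA kindS)[y xE].
  have xi : x i = scat z (scat w (y i)).
    have := gaE (y i) => /(congr1 (fun x : X => x i)).
    by rewrite /iota_ dfwith_in xE !wact_scat dfwith_in => ->.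
  have xM : agree M x0 x.
    move=> j t tM; have [ij|ij] := eqVneq i j.
      by case: j / ij; rewrite xi zE.
    rewrite xE wact_scat /ga dfwith_out // /scat.
    by rewrite (set_nth_default ord0) ?size_mkseq // nth_mkseq.
  have [_ sl] := slice (MN _ xM).
  exists (y i); rewrite /kappa.
  suff <- : x = iota_ (scat w (y i)) by rewrite hx dfwith_in.
  apply: functional_extensionality_dep => j; rewrite /iota_.
  have [ij|ij] := eqVneq i j; first by case: j / ij; rewrite dfwith_in xi.
  rewrite dfwith_out // sl 1?eq_sym // => j' kj'.
  by rewrite hx dfwith_out // eq_sym.
- move=> N' c; pose be := dfwith (@wnil J m) (mkseq c N') : word m.
  have qP := proj_cyl mlB be; set q := (em gB be * _)%R in qP.
  have [M' M'P] := proj_depth mlA repA n_gt0 kindS (starring_iso_proj psiI qP).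
  have kE u : sagree N' c (kappa u) <-> inP rhoB q (h (iota_ u)).
    rewrite sagreeP; split=> [[d dE]|].
      apply/(inP_cyl mlB repB kindS); exists (dfwith (h x0) d).
      by rewrite wact_dfwith wact_nil hiota dE.
    move=> /(inP_cyl mlB repB kindS)[y yE]; exists (y k).
    by rewrite /kappa yE wact_scat /be dfwith_in.
  exists M' => u u' uu'; rewrite !kE !hP // (M'P _ (iota_ u')) //.
  apply: dfwith_sagree => t tM'; rewrite /scat; have [tz|zt] := ltnP t (size z).
    by apply: set_nth_default.
  by rewrite !nth_default //; apply: uu'; apply: leq_ltn_trans (leq_subr _ _) tM'.
(* This partial isometry inserts [a] after the leading zeros, that is, prepends [a] to [u]; its
   image under [phi] is locally a prefix replacement. *)
- move=> a; pose e := (em gA (dfwith (@wnil I n) (rcons z a)) *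
    star (em gA (dfwith (@wnil I n) z)))%R.
  have eP : pisom e by exact: pisom_shift.
  have fP := starring_iso_pisom phiI eP.
  have eS u : sends rhoB (phi e) (h (iota_ u)) (h (iota_ (scons a u))).
    apply: sendsE => //.
    have -> : iota_ u = wact (dfwith (@wnil I n) z) (dfwith x0 u).
      by rewrite wact_dfwith wact_nil.
    have -> : iota_ (scons a u) =
        wact (dfwith (@wnil I n) (rcons z a)) (dfwith x0 u).
      by rewrite wact_dfwith wact_nil scat_rcons.
    exact: sends_shift.
  have [N0 N0P] := pisom_local mlB repB m_gt0 kindS fP.
  exists N0 => N' u NN; have [none|[w wE]] := N0P N' (h (iota_ u)) NN.
    by have := none _ (fun _ _ _ => erefl) (h (iota_ (scons a u))); rewrite eS.
  exists (w k) => u' uu'.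
  have /wE : agree N' (h (iota_ u)) (h (iota_ u')).
    by rewrite !hiota; exact: dfwith_sagree.
  by move=> /(sends_uniq mlB repB kindS fP (eS u')) hE; rewrite /kappa hE.
Qed.
End Slice.

(** With equal cardinalities [sigma] is bijective, so each [s i] reduces to [sigma i] and the
    hypothesis [slice] holds. *)
Lemma coords_dvd : #|I| = #|J| ->
  exists sigma : I -> J, bijective sigma /\ forall i, m (sigma i) %| n i.
Proof.
move=> IJ; have [N [s [sigma [sE sP sN]]]] := axes_matching; exists sigma.
have s_inj : injective sigma.
  move=> i i' ii'; apply/eqP; apply: contraT => ne.
  by have := sN i' i ne; rewrite -ii' sP.
have [tau sigmaK tauK] := inj_card_bij s_inj (eq_leq (esym IJ)).
split=> [|i]; first by exists tau.
apply: (@slice_dvd N) => x xN; split=> [xi j jk|hx i' ii'].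
  rewrite -(tauK j); apply: (proj1 (sE x (tau j) xN)) (sP _).
  by apply: xi; apply: contraNneq jk => <-; rewrite tauK.
apply/(sE x i' xN) => j js; apply: hx; apply: contraTneq js => ->.
exact: sN.
Qed.
End LocalStructure.

(** * Comparing the two sides *)

Section TwoSided.
Variables (K : realType) (S : starSubring K) (I J : finType).
Variables (n : I -> nat) (m : J -> nat).
Local Notation R := (subring_type S).
Variables (A : starAlgType R) (gA : forall i, 'I_(n i).+1 -> A).
Variables (B : starAlgType R) (gB : forall j, 'I_(m j).+1 -> B).

Lemma starring_iso_coords (phi : A -> B) : kind S ->
  multi_leavitt gA -> multi_leavitt gB ->
  (forall i, (0 < n i)%N) -> (forall j, (0 < m j)%N) -> is_starring_iso phi ->
  #|I| <= #|J| /\ (#|I| = #|J| ->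
    exists sigma : I -> J, bijective sigma /\ forall i, m (sigma i) %| n i).
Proof.
move=> kindS mlA mlB n_gt0 m_gt0 phiI.
have [rhoA repA] := point_rep_exists mlA.
have [rhoB repB] := point_rep_exists mlB.
have [[psi phiK psiK] _ _ _ _] := phiI.
have psiI := starring_iso_inv phiI phiK psiK.
have /choice[h hP] x := point_image mlA mlB repA repB n_gt0 m_gt0 kindS x psiI.
have /choice[h' h'P] y := point_image mlB mlA repB repA m_gt0 n_gt0 kindS y phiI.
have hK : cancel h h'.
  move=> x; apply: (inP_sep mlA repA n_gt0) => p pP.
  by rewrite h'P // hP ?phiK //; exact: starring_iso_proj.
have h'K : cancel h' h.
  move=> y; apply: (inP_sep mlB repB m_gt0) => q qP.
  by rewrite hP // h'P ?psiK //; exact: starring_iso_proj.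
split.
  exact: (coords_leq mlA mlB repA repB n_gt0 m_gt0 kindS phiI phiK psiK hP hK).
by apply: (coords_dvd mlA mlB repA repB n_gt0 m_gt0 kindS phiI phiK psiK hP hK).
Qed.
End TwoSided.

Lemma bij_codom_perm (I J : finType) (n : I -> nat) (m : J -> nat) sigma :
  bijective sigma -> (forall i, m (sigma i) = n i) -> perm_eq (codom n) (codom m).
Proof.
move=> [tau sK tK] mn.
have -> : codom n = map m (codom sigma).
  by rewrite /codom /image_mem -map_comp; apply: eq_map => i /=; rewrite mn.
apply/perm_map/uniq_perm; rewrite ?enum_uniq //.
  by rewrite map_inj_uniq ?enum_uniq //; exact: can_inj sK.
by move=> j; rewrite mem_enum -[j]tK codom_f.
Qed.

(* Each side majorizes the other termwise up to bijection, so the sums agree. *)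
Lemma dvd_bij_perm (I J : finType) (n : I -> nat) (m : J -> nat) sigma tau :
  (forall i, (0 < n i)%N) -> (forall j, (0 < m j)%N) ->
  bijective sigma -> bijective tau ->
  (forall i, m (sigma i) %| n i) -> (forall j, n (tau j) %| m j) ->
  perm_eq (codom n) (codom m).
Proof.
move=> n_gt0 m_gt0 sB tB mn nm; apply: (bij_codom_perm sB).
have msum : \sum_i m (sigma i) = \sum_j m j.
  by rewrite [RHS](reindex sigma) //; exact: onW_bij.
have nsum : \sum_j n (tau j) = \sum_i n i.
  by rewrite [RHS](reindex tau) //; exact: onW_bij.
have le i : m (sigma i) <= n i by exact: dvdn_leq.
have le_nm : \sum_i n i <= \sum_i m (sigma i).
  by rewrite -nsum msum; apply: leq_sum => j _; exact: dvdn_leq.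
move=> i; apply/eqP; rewrite eqn_leq le /=; move: le_nm.
rewrite (bigD1 i) //= [X in _ <= X](bigD1 i) //=.
have : \sum_(i' | i' != i) m (sigma i') <= \sum_(i' | i' != i) n i'.
  by apply: leq_sum => i' _.
by move: (\sum_(i' | _) _) (\sum_(i' | _) _) => u v; lia.
Qed.

Theorem corollary6p4 (K : realType) (S : starSubring K) (kindS : kind S)
    (k l : nat) (k_gt0 : (0 < k)%N) (l_gt0 : (0 < l)%N)
    (n : k.-tuple nat) (m : l.-tuple nat)
    (n_ge2 : forall i, (2 <= tnth n i)%N) (m_ge2 : forall j, (2 <= tnth m j)%N)
    (n_incr : sorted leq n) (m_incr : sorted leq m)
    (phi : leavitt_tensor (subring_type S) n ->
           leavitt_tensor (subring_type S) m)
    (phi_iso : is_starring_iso phi) :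
  k = l /\ n = m :> seq nat.
Proof.
have nm : tval n = tval m; last first.
  by split=> //; rewrite -(size_tuple n) -(size_tuple m) nm.
(* Entries are rewritten as successors to match the index shift of [multi_leavitt]; the bound 2
   makes the predecessors positive, so each alphabet has two letters. *)
have preds r (t : r.-tuple nat) : (0 < r)%N -> (forall i, (2 <= tnth t i)%N) ->
    exists p ps, tval t = [seq q.+1 | q <- p :: ps] /\ all (leq 1) (p :: ps).
  move=> r0 t2; have tall : all (leq 2) t by apply/all_tnthP.
  case: t => -[|q qs] /= qr in t2 tall *; first by rewrite -(eqP qr) in r0.
  exists q.-1, (map predn qs); case/andP: tall => q2 qs2; split.
    rewrite /= -map_comp prednK ?(leq_trans _ q2) //; congr cons.
    rewrite -[LHS]map_id; apply/eq_in_map => x /(allP qs2) /=.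
    by case: x.
  apply/andP; split; first by lia.
  by apply/allP => _ /mapP[x /(allP qs2) x2 ->]; case: x x2 => [|[]].
have [p [ps [nE n1]]] := preds _ _ k_gt0 n_ge2.
have [q [qs [mE m1]]] := preds _ _ l_gt0 m_ge2.
rewrite {}nE {}mE in n_incr m_incr phi phi_iso *.
have [I [nI [gA [mlA nIE]]]] := leavitt_tensor_multi_leavitt (subring_type S) p ps.
have [J [mJ [gB [mlB mJE]]]] := leavitt_tensor_multi_leavitt (subring_type S) q qs.
have nI0 i : (0 < nI i)%N.
  by move/allP: n1; apply; rewrite -(perm_mem nIE) codom_f.
have mJ0 j : (0 < mJ j)%N.
  by move/allP: m1; apply; rewrite -(perm_mem mJE) codom_f.
have [leIJ dvdIJ] := starring_iso_coords kindS mlA mlB nI0 mJ0 phi_iso.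
have [[psi phiK psiK] _ _ _ _] := phi_iso.
have psi_iso := starring_iso_inv phi_iso phiK psiK.
have [leJI dvdJI] := starring_iso_coords kindS mlB mlA mJ0 nI0 psi_iso.
have IJ : #|I| = #|J| by apply/eqP; rewrite eqn_leq leIJ.
have [sigma [sB sD]] := dvdIJ IJ; have [tau [tB tD]] := dvdJI (esym IJ).
apply: (sorted_eq leq_trans anti_leq n_incr m_incr); apply: perm_map.
rewrite -(permPl nIE) -(permPr mJE).
exact: dvd_bij_perm sB tB sD tD.
Qed.
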